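(* Let $(x^{*},u^{*})$ be an optimal pair for the distributed-order fractional optimal control problem $$J[x,u]=\int_a^b L(t,x(t),u(t))\,dt\longrightarrow\max,\qquad {}^{C}\mathbb{D}^{\psi(\cdot)}_{a^{+}}x(t)=f(t,x(t),u(t))\ \text{ for a.e. } t\in[a,b],$$ $$x\in AC^{\alpha}([a,b],\mathbb{R}^n),\quad u\in L^{\infty}([a,b],\mathbb{R}^m),\quad x(a)=x_a\in\mathbb{R}^n,\quad u(t)\in\Omega,$$ where $\Omega\subset\mathbb{R}^m$ is closed and $f$, $L$ satisfy the assumptions (i)–(iv) listed in the context. Let $\mathcal{L}[F(\cdot)]$ denote the set of all points of $[a,b)$ that are Lebesgue points of both essentially bounded functions $t\mapsto f(t,x^{*}(t),u^{*}(t))$ and $t\mapsto L(t,x^{*}(t),u^{*}(t))$. Let $(\tau,v)\in\mathcal{L}[F(\cdot)]\times\Omega$ and, for every $\theta\in[0,b-\tau)$, let $u^{\theta}\in L^{\infty}([a,b],\mathbb{R}^m)$ be the needle-like variation of $u^{*}$ given, for almost every $t\in[a,b]$, by $$u^{\theta}(t)=\begin{cases}u^{*}(t)&\text{if } t\notin[\tau-\theta,\tau),\\ v&\text{if } t\in[\tau-\theta,\tau).\end{cases}$$ Let $x^{\theta}$ be the state trajectory corresponding to $u^{\theta}$, that is, the solution of $${}^{C}\mathbb{D}^{\psi(\cdot)}_{a^{+}}x^{\theta}(t)=f(t,x^{\theta}(t),u^{\theta}(t)),\qquad x^{\theta}(a)=x_a.$$ Then $x^{\theta}$ converges uniformly on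 $[a,b]$ to the optimal state trajectory $x^{*}$ as $\theta$ tends to zero.
   Context: Let $a<b$ be real numbers and let $\alpha\in[0,1]$. Function spaces. $I^{\beta}_{a^{+}}$ and $I^{\beta}_{b^{-}}$ denote the left and right Riemann–Liouville fractional integrals of order $\beta$ on $[a,b]$, and $AC$ denotes absolutely continuous functions. Define $$L^{\alpha}([a,b],\mathbb{R}^n)=\{x\in L^{1}([a,b],\mathbb{R}^n): I^{\alpha}_{a^{+}}x,\ I^{\alpha}_{b^{-}}x\in AC([a,b],\mathbb{R}^n)\}.$$ $AC^{\alpha}([a,b],\mathbb{R}^n)$ is the set of absolutely continuous functions $x$ that can be represented as $x(t)=x(a)+I^{\alpha}_{a^{+}}f_1(t)$ and $x(t)=x(b)+I^{\alpha}_{b^{-}}f_2(t)$ for some functions $f_1,f_2\in L^{\alpha}$. Distributed-order derivative. $\psi:[0,1]\to[0,\infty)$ is a continuous function with $\int_0^1\psi(\beta)\,d\beta>0$. The left Caputo distributed-order derivative is $${}^{C}\mathbb{D}^{\psi(\cdot)}_{a^{+}}x(t)=\int_0^1\psi(\beta)\,{}^{C}D^{\beta}_{a^{+}}x(t)\,d\beta,$$ where ${}^{C}D^{\beta}_{a^{+}}$ is the left Caputo fractional derivative of order $\beta$. Assumptions on the data $f:[a,b]\times\mathbb{R}^n\times\mathbb{R}^m\to\mathbb{R}^n$ and $L:[a,b]\times\mathbb{R}^n\times\mathbb{R}^m\to\mathbb{R}$: (i) $f$ is continuous in all its three arguments. (ii) $f$ is continuously differentiable with respect to $x$ and, in particular,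 locally Lipschitz: for every compact $B\subset\mathbb{R}^n$ there is $K>0$ such that $\|f(t,x,u)-f(t,y,u)\|\le K\|x-y\|$ for all $x,y\in B$, $t\in[a,b]$, $u\in\mathbb{R}^m$. (iii) There exists $M>0$ such that $\|f(t,x,u)\|\le M$ for all $(t,x)\in[a,b]\times\mathbb{R}^n$ and all $u\in\mathbb{R}^m$. (iv) $L$ satisfies the same assumptions (i)–(iii) as $f$. An admissible pair is a pair $(x,u)$ satisfying all the constraints of the problem; an optimal pair is an admissible pair maximizing $J$ among all admissible pairs. *)

(* Defs.v *)
From HB Require Import structures.
From mathcomp Require Import all_boot all_order all_algebra.
From mathcomp Require Import all_classical all_reals all_analysis.

Set Implicit Arguments.
Unset Strict Implicit.
Unset Printing Implicit Defensive.

Import Order.TTheory GRing.Theory Num.Theory.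
Import numFieldNormedType.Exports.

Local Open Scope classical_set_scope.
Local Open Scope ring_scope.

(* Vectors of R^n are row vectors 'rV[R]_n, with the library's max norm.  The
   norm only enters through boundedness, Lipschitz, convergence and
   absolute-continuity conditions, which do not depend on the choice of a norm
   on R^n.  Functions on [a, b] are total functions on R whose values outside
   [a, b] are never used. *)

Section function_spaces.
Context {R : realType}.
Local Notation mu := (@lebesgue_measure R).

Definition abs_cont {V : normedModType R} (a b : R) (x : R -> V) : Prop :=
  forall eps : R, 0 < eps -> exists2 delta : R, 0 < delta &
    forall (k : nat) (s e : 'I_k -> R),
      (forall i, [/\ a <= s i, s i <= e i & e i <= b]) ->
      trivIset [set: 'I_k] (fun i => `]s i, e i[%classic) ->
      \sum_(i < k) (e i - s i) < delta ->
      \sum_(i < k) `|x (e i) - x (s i)| < eps.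

Definition L1 {n : nat} (a b : R) (x : R -> 'rV[R]_n) : Prop :=
  forall i, mu.-integrable `[a, b] (fun t => (x t 0 i)%:E).

Definition Linfty {n : nat} (a b : R) (x : R -> 'rV[R]_n) : Prop :=
  (forall i, measurable_fun `[a, b] (fun t => x t 0 i)) /\
  exists M : R, {ae mu, forall t, t \in `[a, b] -> `|x t| <= M}.

Definition Gamma (z : R) : R :=
  \int[mu]_(t in `]0, +oo[) (t `^ (z - 1) * expR (- t)).

(* Riemann-Liouville integrals, with the convention that order 0 is the
   identity. *)
Definition RL_left (a beta : R) (x : R -> R) (t : R) : R :=
  if beta == 0 then x t
  else (Gamma beta)^-1 * \int[mu]_(s in `[a, t]) ((t - s) `^ (beta - 1) * x s).

Definition RL_right (b beta : R) (x : R -> R) (t : R) : R :=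
  if beta == 0 then x t
  else (Gamma beta)^-1 * \int[mu]_(s in `[t, b]) ((s - t) `^ (beta - 1) * x s).

Definition RL_leftv {n : nat} (a beta : R) (x : R -> 'rV[R]_n) (t : R) :
  'rV[R]_n := \row_i RL_left a beta (fun s => x s 0 i) t.

Definition RL_rightv {n : nat} (b beta : R) (x : R -> 'rV[R]_n) (t : R) :
  'rV[R]_n := \row_i RL_right b beta (fun s => x s 0 i) t.

(* For x in L^1 the functions I^alpha x are only determined almost everywhere,
   so membership in AC means having an absolutely continuous representative. *)
Definition AC_class {n : nat} (a b : R) (x : R -> 'rV[R]_n) : Prop :=
  exists2 y : R -> 'rV[R]_n, abs_cont a b y &
    {ae mu, forall t, t \in `[a, b] -> x t = y t}.

Definition Lalpha {n : nat} (a b alpha : R) (x : R -> 'rV[R]_n) : Prop :=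
  [/\ L1 a b x, AC_class a b (RL_leftv a alpha x)
    & AC_class a b (RL_rightv b alpha x)].

Definition ACalpha {n : nat} (a b alpha : R) (x : R -> 'rV[R]_n) : Prop :=
  [/\ abs_cont a b x,
      exists2 f1, Lalpha a b alpha f1 &
        forall t, t \in `[a, b] -> x t = x a + RL_leftv a alpha f1 t
    & exists2 f2, Lalpha a b alpha f2 &
        forall t, t \in `[a, b] -> x t = x b + RL_rightv b alpha f2 t].

(* Lebesgue points relative to [a, b]: the averages are taken over the part of
   the ball lying in [a, b], so that the endpoints are not excluded. *)
Definition lebesgue_pt_in {V : normedModType R} (a b : R) (g : R -> V)
    (t : R) : Prop :=
  iavg (fun s => `|g s - g t|) (ball t r `&` `[a, b]) @[r --> (0 : R)^'+]
    --> (0 : \bar R).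

End function_spaces.

Section distributed_order.
Context {R : realType}.
Local Notation mu := (@lebesgue_measure R).

(* The Caputo derivative of order beta in [0, 1] of an absolutely continuous
   function is I^(1 - beta) applied to x'. *)
Definition Caputo_left (a beta : R) (x : R -> R) : R -> R :=
  RL_left a (1 - beta) (derive1 x).

Definition distr_Caputo_left {n : nat} (psi : R -> R) (a : R)
    (x : R -> 'rV[R]_n) (t : R) : 'rV[R]_n :=
  \row_i \int[mu]_(beta in `[0, 1])
    (psi beta * Caputo_left a beta (fun s => x s 0 i) t).

Definition distr_weight (psi : R -> R) : Prop :=
  [/\ {within `[0, 1], continuous psi},
      forall beta, beta \in `[0, 1] -> 0 <= psi beta
    & 0 < \int[mu]_(beta in `[0, 1]) psi beta].

End distributed_order.

Section control_problem.
Context {R : realType} {n m : nat}.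
Local Notation mu := (@lebesgue_measure R).

Definition C1_in_state {V : normedModType R} (a b : R)
    (f : R -> 'rV[R]_n -> 'rV[R]_m -> V) : Prop :=
  forall t u, t \in `[a, b] ->
    (forall x, differentiable (fun y => f t y u) x) /\
    (forall h, continuous (fun x => 'd (fun y => f t y u) x h)).

Definition data_assumptions {V : normedModType R} (a b : R)
    (f : R -> 'rV[R]_n -> 'rV[R]_m -> V) : Prop :=
  [/\ {within [set z : R * 'rV[R]_n * 'rV[R]_m | z.1.1 \in `[a, b]],
         continuous (fun z => f z.1.1 z.1.2 z.2)},
      C1_in_state a b f,
      forall B : set 'rV[R]_n, compact B ->
        exists2 K : R, 0 < K & forall x y t u, B x -> B y -> t \in `[a, b] ->
          `|f t x u - f t y u| <= K * `|x - y|
    & exists2 M : R, 0 < M & forall t x u, t \in `[a, b] -> `|f t x u| <= M].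

Definition state_trajectory (a b alpha : R) (psi : R -> R)
    (f : R -> 'rV[R]_n -> 'rV[R]_m -> 'rV[R]_n) (xa : 'rV[R]_n)
    (u : R -> 'rV[R]_m) (x : R -> 'rV[R]_n) : Prop :=
  [/\ ACalpha a b alpha x,
      {ae mu, forall t, t \in `[a, b] ->
         distr_Caputo_left psi a x t = f t (x t) (u t)}
    & x a = xa].

Definition admissible (a b alpha : R) (psi : R -> R)
    (f : R -> 'rV[R]_n -> 'rV[R]_m -> 'rV[R]_n) (xa : 'rV[R]_n)
    (Omega : set 'rV[R]_m) (x : R -> 'rV[R]_n) (u : R -> 'rV[R]_m) : Prop :=
  [/\ state_trajectory a b alpha psi f xa u x,
      Linfty a b u
    & {ae mu, forall t, t \in `[a, b] -> Omega (u t)}].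

Definition objective (a b : R) (L : R -> 'rV[R]_n -> 'rV[R]_m -> R)
    (x : R -> 'rV[R]_n) (u : R -> 'rV[R]_m) : R :=
  \int[mu]_(t in `[a, b]) L t (x t) (u t).

Definition optimal_pair (a b alpha : R) (psi : R -> R)
    (f : R -> 'rV[R]_n -> 'rV[R]_m -> 'rV[R]_n)
    (L : R -> 'rV[R]_n -> 'rV[R]_m -> R) (xa : 'rV[R]_n)
    (Omega : set 'rV[R]_m) (x : R -> 'rV[R]_n) (u : R -> 'rV[R]_m) : Prop :=
  admissible a b alpha psi f xa Omega x u /\
  forall y w, admissible a b alpha psi f xa Omega y w ->
    objective a b L y w <= objective a b L x u.

Definition needle_variation (a b tau theta : R) (v : 'rV[R]_m)
    (u utheta : R -> 'rV[R]_m) : Prop :=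
  Linfty a b utheta /\
  {ae mu, forall t, t \in `[a, b] ->
     utheta t = if t \in `[tau - theta, tau[ then v else u t}.

End control_problem.

(* Main.v *)
Require Import Defs.
From HB Require Import structures.
From mathcomp Require Import all_boot all_order all_algebra.
From mathcomp Require Import all_classical all_reals all_analysis.
From mathcomp Require Import measurable_realfun.
From mathcomp Require Import ring lra.

Set Implicit Arguments.
Unset Strict Implicit.
Unset Printing Implicit Defensive.

Import Order.TTheory GRing.Theory Num.Theory.
Import numFieldNormedType.Exports.

Local Open Scope classical_set_scope.
Local Open Scope ring_scope.

(** Absolutely continuous functions have an integrable density, and for them the
    distributed-order derivative is the convolution of that density with
    [k u = int_0^1 psi(b) u^-b / Gamma(1-b) db], a nonincreasing positive kernel
    that is integrable near [0] and tends to [+oo] at [0].  For such kernels there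
    is a maximum principle: if [z a = 0], [z <= S] on [[a, p]] and [k * z' <= C] on
    [[p, q]], then [z <= S + C / k (q - p)] on [[a, q]].  It is proved by comparing
    [k * z'] averaged over a short window with the window average of [z] at a
    maximum point of the latter, using only the monotonicity of [k].

    Apply it to the coordinates of [xtheta - xs].  Before the needle the difference
    vanishes; on the needle the right-hand sides differ by at most [2 M], so the
    difference is at most [2 M / k theta]; after the needle the right-hand sides
    differ by at most [K |xtheta - xs|], so on each step of length [d] with
    [2 K <= k d] the supremum at most doubles.  Finitely many steps give a bound
    [A / k theta], which tends to [0]. *)

(** The kernel [k] has no explicit inverse in general, so the estimates come from comparison at a
    maximum point rather than from an integral equation for the trajectory. Such a comparison cannot
    be made on [z] itself: the bound on [k * z'] holds only almost everywhere, and [z] is merely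
    absolutely continuous. Integrating over a window of length [h] replaces [z'] by the bounded
    function [z r - z (r - h)], makes the inequality available at every point, and costs an error
    governed by the modulus of continuity of [z], which disappears with [h].

    The gain [C / k (q - p)] is small on short intervals because [k] blows up at [0]. This serves
    twice: for the needle, and for the steps of length [d], where the Lipschitz term is absorbed as
    half of the supremum. Since [f] is bounded, comparison with the constant [xa] puts all
    trajectories into one compact box, so [K], [d], the number of steps and hence [A] depend neither
    on [theta] nor on the control. *)

(** * Absolute continuity and total variation on lists of intervals *)

Section absolutely_continuous.
Context {R : realType}.
Implicit Types (a b : R) (w : R -> R) (l : seq (R * R)).

Definition nonoverlapping (p q : R * R) := (p.2 <= q.1) || (q.2 <= p.1).

Definition subintervals a b l :=
  all (fun p => [&& a <= p.1, p.1 <= p.2 & p.2 <= b]) l &&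
  pairwise nonoverlapping l.

Definition sum_length l : R := \sum_(p <- l) (p.2 - p.1).
Definition sum_incr w l : R := \sum_(p <- l) `|w p.2 - w p.1|.

(** Lists of pairs instead of families over ['I_k]: bounding the total variation replaces an
    interval by the pieces of a partition, which on lists is concatenation. *)
Definition abs_cont_seq a b w := forall eps : R, 0 < eps ->
  exists2 delta : R, 0 < delta &
  forall l, subintervals a b l -> sum_length l < delta -> sum_incr w l < eps.

Lemma nonoverlappingC p q : nonoverlapping p q = nonoverlapping q p.
Proof. by rewrite /nonoverlapping orbC. Qed.

(** The domination hypothesis covers the coordinates of a vector function and constant functions
    alike. *)
Lemma abs_cont_abs_cont_seq {V : normedModType R} a b (x : R -> V) w :
  abs_cont a b x -> (forall s t, `|w t - w s| <= `|x t - x s|) ->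
  abs_cont_seq a b w.
Proof.
move=> acx wx e e0; have [d d0 xd] := acx _ e0; exists d => // l /andP[lab pl] ld.
apply: (@le_lt_trans _ _ (\sum_(p <- l) `|x p.2 - x p.1|)).
  by apply: ler_sum => p _; exact: wx.
pose s (i : 'I_(size l)) := (nth (0, 0) l i).1.
pose t (i : 'I_(size l)) := (nth (0, 0) l i).2.
have := xd (size l) s t; rewrite (big_nth (0, 0)) big_mkord; apply.
- by move=> i; have /(_ _ (mem_nth (0,0) (ltn_ord i)))/and3P[] := allP lab.
- have /(pairwiseP (0, 0)) H := pl.
  have nov (i j : 'I_(size l)) : (i < j)%N -> `]s i, t i[ `&` `]s j, t j[ = set0.
    move=> ij; have := H i j; rewrite !inE !ltn_ord => /(_ isT isT ij) nij.
    rewrite -subset0 => z [] /=; rewrite !in_itv/= => /andP[s1 t1] /andP[s2 t2].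
    by move: nij; rewrite /nonoverlapping -/(t i) -/(t j) -/(s i) -/(s j) => /orP[]; lra.
  apply/trivIsetP => i j _ _; case: (ltngtP i j) => [|ji|/val_inj ->].
  + by move=> ij _; exact: nov.
  + by move=> _; rewrite setIC; exact: nov.
  + by rewrite eqxx.
- by move: ld; rewrite /sum_length (big_nth (0,0)) big_mkord.
Qed.

Fixpoint consecutive a (s : seq R) : seq (R * R) :=
  if s is c :: s' then (a, c) :: consecutive c s' else [::].

Lemma sum_length_consecutive a b s : itv_partition a b s ->
  sum_length (consecutive a s) = b - a.
Proof.
elim: s a => [|c s IH] a.
  by move/itv_partition_nil ->; rewrite /sum_length big_nil subrr.
by move=> [/= /andP[ac cs] lst]; rewrite /sum_length big_cons/= -/(sum_length _) IH; [lra|split].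
Qed.

Lemma sum_incr_consecutive a b s w : itv_partition a b s ->
  sum_incr w (consecutive a s) = variation a b w s.
Proof.
elim: s a => [|c s IH] a.
  by move=> _; rewrite variation_nil /sum_incr big_nil.
move=> [/= /andP[ac cs] lst]; rewrite /sum_incr big_cons/= -/(sum_incr _ _).
by rewrite IH; [rewrite /variation/= big_nat_recl//|split].
Qed.

Lemma subintervals_consecutive a b s : itv_partition a b s ->
  subintervals a b (consecutive a s).
Proof.
elim: s a => [|c s IH] a //.
move=> [/= /andP[ac cs] lst]; have cbs : itv_partition c b s by split.
have /andP[/allP abl pl] := IH _ cbs; have cb := itv_partition_le cbs.
rewrite /subintervals/= lexx (ltW ac) cb/= pl andbT; apply/andP; split.
  by apply/allP => p /abl /and3P[cp -> ->]; rewrite (le_trans (ltW ac) cp).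
by apply/allP => p /abl /and3P[cp _ _]; rewrite /nonoverlapping/= cp.
Qed.

Lemma nonoverlapping_consecutive a b s (q : R * R) : itv_partition a b s ->
  nonoverlapping (a, b) q -> {in consecutive a s, forall p, nonoverlapping p q}.
Proof.
move=> /subintervals_consecutive /andP[/allP abl _] abq p /abl.
by move: abq; rewrite /nonoverlapping/= => /orP[] ? /and3P[? ? ?]; apply/orP; [left|right]; lra.
Qed.

(** Refining an interval by a partition keeps the total length, so the same [delta] serves for the
    variations. The induction runs over two lists: intervals in [l] count with their variation,
    those in [l2] with their increment, and each step moves the pieces of one partition to the
    second list before taking the supremum. *)
Lemma abs_cont_total_variation a b w : abs_cont_seq a b w ->
  forall eps : R, 0 < eps -> exists2 delta : R, 0 < delta &
  forall l, subintervals a b l -> sum_length l < delta ->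
  (\sum_(p <- l) total_variation p.1 p.2 w <= eps%:E)%E.
Proof.
move=> acw e e0; have [d d0 H] := acw _ e0; exists d => // l.
rewrite -(cats0 l) big_cat big_nil/= adde0.
have -> : (\sum_(p <- l) total_variation p.1 p.2 w =
  \sum_(p <- l) total_variation p.1 p.2 w + (sum_incr w [::])%:E)%E.
  by rewrite /sum_incr big_nil adde0.
elim: l [::] => [|p l IH] l2 sl2 dl2.
  by rewrite big_nil add0e lee_fin ltW// H.
have /and3P[ap p12 pb] : [&& a <= p.1, p.1 <= p.2 & p.2 <= b].
  by move: sl2 => /andP[/=/andP[]].
have sl2' : subintervals a b (l ++ l2).
  by move: sl2; rewrite /subintervals/= => /andP[/andP[_ ->] /andP[_ ->]].
have dE m m' : sum_length (m ++ m') = sum_length m + sum_length m'.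
  by rewrite /sum_length big_cat.
have dp : sum_length (p :: l) = p.2 - p.1 + sum_length l.
  by rewrite /sum_length big_cons.
have [p12e|/eqP p12e] := eqVneq p.1 p.2.
  rewrite big_cons p12e total_variationxx add0e; apply: IH => //.
  by move: dl2; rewrite !dE dp p12e subrr add0r.
rewrite big_cons -addeA -leeBrDr; last first.
  have : (\sum_(p <- l) total_variation p.1 p.2 w + (sum_incr w l2)%:E <= e%:E)%E.
    by apply: IH => //; move: dl2; rewrite !dE dp; lra.
  move=> H1; rewrite fin_real//; apply/andP; split; last exact: le_lt_trans H1 (ltry _).
  apply: (@lt_le_trans _ _ 0%E) => //; apply: adde_ge0.
    rewrite big_seq; apply: sume_ge0 => q ql; apply: total_variation_ge0.
    move: sl2' => /andP[/allP/(_ q)]; rewrite mem_cat ql/= => /(_ isT)/and3P[_ ? _] _.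
    by [].
  by rewrite lee_fin; apply: sumr_ge0.
apply: ge_ereal_sup => _ [_ [s ps <-] <-].
rewrite leeBrDr; last first.
  have : (\sum_(p <- l) total_variation p.1 p.2 w + (sum_incr w l2)%:E <= e%:E)%E.
    by apply: IH => //; move: dl2; rewrite !dE dp; lra.
  move=> H1; rewrite fin_real//; apply/andP; split; last exact: le_lt_trans H1 (ltry _).
  apply: (@lt_le_trans _ _ 0%E) => //; apply: adde_ge0.
    rewrite big_seq; apply: sume_ge0 => q ql; apply: total_variation_ge0.
    move: sl2' => /andP[/allP/(_ q)]; rewrite mem_cat ql/= => /(_ isT)/and3P[_ ? _] _.
    by [].
  by rewrite lee_fin; apply: sumr_ge0.
rewrite addeCA -EFinD -(sum_incr_consecutive _ ps).
rewrite /sum_incr -big_cat/=; apply: IH; last first.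
  by move: dl2; rewrite !dE dp (sum_length_consecutive ps); lra.
have := subintervals_consecutive ps.
move: sl2; rewrite /subintervals/= !all_cat !pairwise_cat.
move=> /andP[/andP[_ /andP[-> ->]]]/andP[pll2 /and3P[ll2 -> ->]] /andP[/allP cons ->].
rewrite /= !andbT; move: pll2 => /andP[pl pl2].
apply/and3P; split.
- by apply/allP => q /cons /and3P[? ? ?]; apply/and3P; split; lra.
- rewrite allrel_catr ll2 andbT; apply/allrelP => x y xl yc.
  rewrite nonoverlappingC; apply: (nonoverlapping_consecutive ps) => //.
  by rewrite -surjective_pairing; apply: (allP pl).
- apply/allrelP => x y xl yc.
  apply: (nonoverlapping_consecutive ps) => //.
  by rewrite -surjective_pairing; apply: (allP pl2).
Qed.

End absolutely_continuous.

(** * The variation function of an absolutely continuous function *)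

Section absolutely_continuous_variation.
Context {R : realType}.
Implicit Types (a b : R) (w : R -> R) (l : seq (R * R)).

Lemma subintervals1 a b s t : a <= s -> s <= t -> t <= b ->
  subintervals a b [:: (s, t)].
Proof. by move=> sa st tb; rewrite /subintervals/= sa st tb. Qed.

Lemma abs_cont_seq_uniform a b w : abs_cont_seq a b w ->
  forall eps : R, 0 < eps -> exists2 delta : R, 0 < delta &
  forall s t, a <= s <= b -> a <= t <= b -> `|t - s| < delta ->
  `|w t - w s| < eps.
Proof.
move=> acw e e0; have [d d0 H] := acw _ e0; exists d => // s t.
wlog st : s t / s <= t => [hw sab tab std|/andP[sa _] /andP[_ tb] std].
  by case: (leP s t) => [|/ltW] /hw; [|rewrite distrC (distrC (w t))]; exact.
have := H _ (subintervals1 sa st tb).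
by rewrite /sum_length /sum_incr !big_seq1/=; apply; rewrite ger0_norm// in std; lra.
Qed.

Lemma abs_cont_seqB a b w1 w2 : abs_cont_seq a b w1 -> abs_cont_seq a b w2 ->
  abs_cont_seq a b (w1 \- w2).
Proof.
move=> ac1 ac2 e e0; have e20 : 0 < e / 2 by lra.
have [d1 d10 H1] := ac1 _ e20; have [d2 d20 H2] := ac2 _ e20.
exists (Num.min d1 d2) => [|l sl]; first by rewrite lt_min d10.
rewrite lt_min => /andP[/(H1 _ sl) l1 /(H2 _ sl) l2].
apply: (@le_lt_trans _ _ (sum_incr w1 l + sum_incr w2 l)); last by lra.
rewrite /sum_incr -big_split/=; apply: ler_sum => p _.
by rewrite opprD addrACA (le_trans (ler_normD _ _))// -opprD normrN lexx.
Qed.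

(** The variation is at most [1] on intervals shorter than [d], and finitely many of length [d / 2]
    reach from [a] to [t]. *)
Lemma abs_cont_total_variation_lty a b w t : abs_cont_seq a b w ->
  a <= t <= b -> (total_variation a t w < +oo)%E.
Proof.
move=> acw; have [d d0 H] := abs_cont_total_variation acw ltr01.
have step s r : a <= s -> s <= r -> r <= b -> r - s < d ->
    (total_variation s r w < +oo)%E.
  move=> sa sr rb srd; have := H _ (subintervals1 sa sr rb).
  by rewrite /sum_length !big_seq1/= => /(_ srd) /le_lt_trans; apply; exact: ltry.
have {H} main n : forall t, a <= t <= b -> t - a <= n%:R * (d / 2) ->
    (total_variation a t w < +oo)%E.
  elim: n => [|n IH] {}t /andP[ta tb].
    rewrite mul0r => h; have -> : t = a by lra.
    by rewrite total_variationxx.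
  rewrite -natr1 mulrDl mul1r => h.
  case: (leP (t - a) (n%:R * (d / 2))) => [h'|h']; first by apply: IH; rewrite ?ta.
  have nd : 0 <= n%:R * (d / 2) by rewrite mulr_ge0//; lra.
  rewrite (@total_variationD _ a t (a + n%:R * (d / 2)))//; [|lra..].
  by apply: lte_add_pinfty; [apply: IH; lra|apply: step; lra].
move=> tab; have [n hn] : exists n : nat, t - a <= n%:R * (d / 2).
  have := archi_boundP (divr_ge0 (_ : 0 <= t - a) (_ : 0 <= d / 2)).
  set n := Num.bound _ => /(_ ltac:(lra) ltac:(lra)) h.
  by exists n; rewrite -ler_pdivrMr; [exact: ltW|lra].
exact: main hn.
Qed.

Definition variation_fun a w t := fine (total_variation a t w).

Lemma total_variation_variation_fun a b w s t : abs_cont_seq a b w ->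
  a <= s -> s <= t -> t <= b ->
  total_variation s t w = (variation_fun a w t - variation_fun a w s)%:E.
Proof.
move=> acw sa st tb; rewrite /variation_fun.
have fin r : a <= r <= b -> total_variation a r w \is a fin_num.
  move=> rab; rewrite ge0_fin_numE ?(abs_cont_total_variation_lty acw)//.
  by apply: total_variation_ge0; lra.
rewrite EFinB !fineK ?fin//; [|lra..].
by rewrite (@total_variationD _ a t s)// addeAC subee ?add0e ?fin//; lra.
Qed.

Lemma variation_fun_incr a b w s t : abs_cont_seq a b w ->
  a <= s -> s <= t -> t <= b ->
  `|w t - w s| <= variation_fun a w t - variation_fun a w s.
Proof.
move=> acw sa st tb; rewrite -lee_fin -(total_variation_variation_fun acw)//.
exact: total_variation_ge.
Qed.

Lemma abs_cont_seq_variation_fun a b w : abs_cont_seq a b w ->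
  abs_cont_seq a b (variation_fun a w).
Proof.
move=> acw e e0; have e20 : 0 < e / 2 by lra.
have [d d0 H] := abs_cont_total_variation acw e20.
exists d => // l sl /(H _ sl) tvl; apply: (@le_lt_trans _ _ (e / 2)); last by lra.
rewrite -lee_fin; apply: le_trans tvl; rewrite /sum_incr -sumEFin.
rewrite big_seq [leRHS]big_seq; apply: lee_sum => p pl.
move: sl => /andP[/allP/(_ _ pl)/and3P[ap p12 pb] _].
rewrite (total_variation_variation_fun acw)// ger0_norm//.
by apply: le_trans (variation_fun_incr acw ap p12 pb).
Qed.

End absolutely_continuous_variation.

(** * Density of a nondecreasing absolutely continuous function *)

Section stieltjes_density.
Context {R : realType}.
Local Notation mu := (@lebesgue_measure R).
Variables (a b : R) (F : R -> R).
Hypotheses (ab : a < b) (acF : abs_cont_seq a b F)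
  (ndF : forall s t, a <= s -> s <= t -> t <= b -> F s <= F t).

Definition clamp (t : R) : R := Num.min b (Num.max a t).

Lemma clamp_itv t : a <= clamp t <= b.
Proof. by rewrite /clamp le_min ge_min le_max !lexx (ltW ab). Qed.

Lemma clampE t : a <= t <= b -> clamp t = t.
Proof. by move=> /andP[a_t tb]; rewrite /clamp max_r// min_r. Qed.

Lemma le_clamp s t : s <= t -> clamp s <= clamp t.
Proof.
move=> st; rewrite /clamp le_min ge_min lexx/=.
by rewrite ge_min ge_max le_max !le_max lexx st/= !orbT.
Qed.

Lemma clamp_dist s t : `|clamp t - clamp s| <= `|t - s|.
Proof.
wlog st : s t / s <= t => [hw|].
  by case: (leP s t) => [|/ltW] /hw //; rewrite distrC (distrC t).
rewrite !ger0_norm ?subr_ge0 ?le_clamp//.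
by rewrite /clamp /Num.max /Num.min; do !case: ifPn; rewrite -?leNgt; lra.
Qed.

(** Extending [F] by constants makes it nondecreasing and right-continuous on the whole line, as a
    Stieltjes measure requires. *)
Definition clamped : R -> R := F \o clamp.

Let clamped_nd : {homo clamped : x y / x <= y}.
Proof.
move=> x y xy; have /andP[? ?] := clamp_itv x; have /andP[? ?] := clamp_itv y.
by apply: ndF => //; exact: le_clamp.
Qed.

Let clamped_rc : right_continuous clamped.
Proof.
move=> x; apply: cvg_at_right_filter; apply/cvgrPdist_lt => e e0.
have [d d0 H] := abs_cont_seq_uniform acF e0.
near=> y; rewrite distrC; apply: H; [exact: clamp_itv..|].
apply: (@le_lt_trans _ _ `|x - y|); last by near: y; exact: cvgr_dist_lt.
by rewrite (distrC x); exact: clamp_dist.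
Unshelve. all: by end_near. Qed.

HB.instance Definition _ := isCumulative.Build R _ R clamped clamped_nd clamped_rc.

Local Notation nu := (lebesgue_stieltjes_measure clamped).

Let nu_itv s t : s <= t -> nu `]s, t] = (clamped t - clamped s)%:E.
Proof.
move=> st; rewrite /lebesgue_stieltjes_measure/= /measure_extension.
rewrite measurable_mu_extE; last exact: is_ocitv.
by rewrite /= wlength_itv_bnd.
Qed.

Lemma open_interval_bounded (I : set R) : open I -> is_interval I -> I !=set0 ->
  I `<=` `]a - 1, b + 1[ -> I = `]inf I, sup I[%classic.
Proof.
move=> oI iI _ Iab.
rewrite -[LHS](interior_id I).1// interval_bounded_interior//.
- by exists (a - 1) => x /Iab; rewrite /= in_itv/= => /andP[/ltW].
- by exists (b + 1) => x /Iab; rewrite /= in_itv/= => /andP[_ /ltW].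
Qed.

(** A null set lies in an open set of measure below [delta]. Its components are disjoint intervals,
    so absolute continuity bounds the increments of [F] over finitely many of them by [eps], and the
    bound passes to the countable sum. *)
Let nu_dominated (A : set R) : measurable A -> mu A = 0 ->
  nu (A `&` `]a, b]) = 0.
Proof.
move=> mA A0; apply/eqP; rewrite eq_le measure_ge0 andbT.
apply/lee_addgt0Pr => e e0; rewrite add0e.
have [d d0 H] := acF e0.
have [U [oU AU UAd]] : exists U : set R, [/\ open U, A `<=` U & (mu (U `\` A) < d%:E)%E].
  by apply: (lebesgue_regularity_outer mA _ d0); move: A0 => /= ->; rewrite ltry.
(* The cut makes every component of [V] a bounded interval, determined by its infimum and
   supremum. *)
pose V := U `&` `]a - 1, b + 1[%classic.
have oV : open V by apply: openI => //; exact: interval_open.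
have mU : measurable U by exact: open_measurable.
have mV : measurable V by exact: open_measurable.
have muV : (mu V < d%:E)%E.
  apply: le_lt_trans UAd; apply: (@le_trans _ _ (mu U)).
    by apply: le_measure; rewrite ?inE//; exact: subIsetl.
  rewrite -{1}(setDUK AU) setUC measureU//; [|exact: measurableD|].
    by rewrite /= A0 adde0.
  by rewrite -subset0 => x [[]].
pose I := open_disjoint_itv oV.
have oI i : open (I i) by exact: open_disjoint_itv_open.
have mI i : measurable (I i) by exact: open_measurable.
have IV i : I i `<=` V.
  by move=> x Ix; rewrite (open_disjoint_itv_bigcup oV); exists i.
have IE i : I i !=set0 -> I i = `]inf (I i), sup (I i)[%classic.
  move=> I0; apply: open_interval_bounded => //.
    exact: open_disjoint_itv_is_interval.
  by apply: subset_trans (@IV i) _; exact: subIsetr.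
have Ilt i : I i !=set0 -> inf (I i) < sup (I i).
  by move=> I0; move: (I0) => -[x]; rewrite {1}(IE i)//= in_itv/= => /andP[]; exact: lt_trans.
(* The enumeration of components may contain empty sets, which get the degenerate pair [(a, a)]. The
   others are clamped, since [acF] only speaks of intervals inside [[a, b]]. *)
pose pr i : R * R :=
  if pselect (I i !=set0) then (clamp (inf (I i)), clamp (sup (I i))) else (a, a).
have prab i : [&& a <= (pr i).1, (pr i).1 <= (pr i).2 & (pr i).2 <= b].
  rewrite /pr; case: pselect => [I0|I0]/=; last by rewrite lexx ltW.
  have /andP[-> _] := clamp_itv (inf (I i)).
  have /andP[_ ->] := clamp_itv (sup (I i)).
  by rewrite le_clamp// ltW// Ilt.
have nuI i : (nu (I i) <= `|F (pr i).2 - F (pr i).1|%:E)%E.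
  rewrite /pr; case: pselect => [I0|I0]/=; last first.
    have -> : I i = set0 by move/set0P : I0 => /negP/negPn/eqP.
    by rewrite measure0.
  apply: (@le_trans _ _ (nu `]inf (I i), sup (I i)])).
    apply: le_measure; rewrite ?inE//; first exact: mI.
    by rewrite {1}(IE i I0); apply: subset_itv => //; rewrite bnd_simp.
  by rewrite nu_itv ?(ltW (Ilt _ I0))// lee_fin ler_norm.
have muI i : (((pr i).2 - (pr i).1)%:E <= mu (I i))%E.
  rewrite /pr; case: pselect => [I0|I0]/=; last by rewrite subrr measure_ge0.
  rewrite [in leRHS](IE i I0) lebesgue_measure_itv/= lte_fin (Ilt _ I0) lee_fin.
  have := clamp_dist (inf (I i)) (sup (I i)).
  by rewrite !ger0_norm ?subr_ge0 ?le_clamp// ltW// Ilt.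
have nov i j : i != j -> nonoverlapping (pr i) (pr j).
  move=> ij; rewrite /nonoverlapping /pr.
  case: pselect => [Ii|Ii]; case: pselect => [Ij|Ij]/=; rewrite ?lexx//.
  - have : trivIset [set: nat] I by exact: open_disjoint_itv_trivIset.
    move=> /trivIsetP/(_ i j Logic.I Logic.I ij).
    apply: contraPT; rewrite negb_or -!ltNge => /andP[h1 h2].
    have l1 : inf (I j) < sup (I i).
      by rewrite ltNge; apply/negP => /le_clamp; rewrite leNgt h1.
    have l2 : inf (I i) < sup (I j).
      by rewrite ltNge; apply/negP => /le_clamp; rewrite leNgt h2.
    have l3 := Ilt _ Ii; have l4 := Ilt _ Ij.
    have [z [z1 z2 z3 z4]] : exists z, [/\ inf (I i) < z, z < sup (I i),
        inf (I j) < z & z < sup (I j)].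
      exists ((Num.max (inf (I i)) (inf (I j)) + Num.min (sup (I i)) (sup (I j))) / 2).
      by case: (leP (inf (I i)) (inf (I j))); case: (leP (sup (I i)) (sup (I j))) => *; split; lra.
    apply/eqP/set0P; exists z; split.
      by rewrite (IE i Ii)/= in_itv/= z1.
    by rewrite (IE j Ij)/= in_itv/= z3.
  - by have /andP[->] := clamp_itv (inf (I i)); rewrite orbT.
  - by have /andP[->] := clamp_itv (inf (I j)).
have sumnu n : (\sum_(0 <= i < n) nu (I i) <= e%:E)%E.
  pose l := [seq pr i | i <- index_iota 0 n].
  have sl : subintervals a b l.
    apply/andP; split; first by apply/allP => _ /mapP[i _ ->]; exact: prab.
    rewrite pairwise_map; apply: (@sub_pairwise _ (fun i j => i != j)).
      by move=> i j; exact: nov.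
    by rewrite -uniq_pairwise iota_uniq.
  have ll : sum_length l < d.
    rewrite -lte_fin /sum_length big_map -sumEFin; apply: le_lt_trans muV.
    apply: (@le_trans _ _ (\sum_(0 <= i < n) mu (I i))%E).
      by apply: lee_sum => i _; exact: muI.
    rewrite (open_disjoint_itv_bigcup oV) measure_bigcup;
      [|by move=> i _; exact: mI|exact: open_disjoint_itv_trivIset].
    under [leRHS]eq_eseriesl do rewrite in_setT.
    by apply: nneseries_lim_ge => i _; rewrite measure_ge0.
  have := H _ sl ll; rewrite -lte_fin => /ltW; apply: le_trans.
  by rewrite /sum_incr big_map -sumEFin; apply: lee_sum => i _; exact: nuI.
apply: (@le_trans _ _ (nu V)).
  apply: le_measure; rewrite ?inE//; first exact: measurableI.
  apply: setISS => // x; rewrite /= !in_itv/= => /andP[? ?]; apply/andP; split; lra.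
rewrite (open_disjoint_itv_bigcup oV) measure_bigcup;
  [|by move=> i _; exact: mI|exact: open_disjoint_itv_trivIset].
under eq_eseriesl do rewrite in_setT.
apply: lime_le; first by apply: is_cvg_nneseries => i _ _; rewrite measure_ge0.
by apply: nearW => n; exact: sumnu.
Qed.

(** Radon-Nikodym derivative of the Stieltjes measure of [F] restricted to []a, b]], where it is
    finite and dominated by the Lebesgue measure. *)
Lemma nondecreasing_abs_cont_density : exists f : R -> R,
  [/\ forall x, 0 <= f x, mu.-integrable [set: R] (EFin \o f) &
      forall s t, a <= s -> s <= t -> t <= b ->
        (\int[mu]_(x in `]s, t]) (f x)%:E = (F t - F s)%:E)%E].
Proof.
have mab : measurable (`]a, b]%classic : set (measurableTypeR R)) by exact: measurable_itv.
have nuab : (nu `]a, b] < +oo)%E by rewrite nu_itv ?ltry// ltW.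
pose rho : {finite_measure set (measurableTypeR R) -> \bar R} := mfrestr mab nuab.
have rho_mu : rho `<< mu.
  apply/null_content_dominatesP => A mA A0.
  exact: nu_dominated.
have [g [g0 gfin gint gE]] := radon_nikodym_sigma_finite rho_mu.
exists (fine \o g); split => [x||s t sa st tb].
- exact: fine_ge0.
- by apply: eq_integrable gint => // x _ /=; rewrite fineK.
under eq_integral do rewrite /= fineK//.
rewrite -gE; last exact: measurable_itv.
rewrite /rho/= /mfrestr /mrestr setIidl; last first.
  by move=> x; rewrite /= !in_itv/= => /andP[? ?]; apply/andP; split; lra.
have sab : a <= s <= b by rewrite sa (le_trans st).
have tab : a <= t <= b by rewrite tb (le_trans sa).
by rewrite nu_itv// /clamped/= (clampE sab) (clampE tab).
Qed.

End stieltjes_density.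

(** * Density of an absolutely continuous function *)

Section abs_cont_density.
Context {R : realType}.
Local Notation mu := (@lebesgue_measure R).
Variables (a b : R) (w : R -> R).
Hypotheses (ab : a < b) (acw : abs_cont_seq a b w).

(** Jordan decomposition: [w] is the difference of its variation function [V] and of [V - w]. Both
    are nondecreasing and absolutely continuous, so each has a density. *)
Lemma abs_cont_density : exists2 f : R -> R,
  mu.-integrable [set: R] (EFin \o f) &
  forall t, a <= t <= b -> w t = w a + \int[mu]_(x in `[a, t]) f x.
Proof.
have acF := abs_cont_seq_variation_fun acw.
have ndF s t : a <= s -> s <= t -> t <= b ->
    variation_fun a w s <= variation_fun a w t.
  move=> sa st tb; rewrite -subr_ge0.
  exact: le_trans (variation_fun_incr acw sa st tb).
have acG := abs_cont_seqB acF acw.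
have ndG s t : a <= s -> s <= t -> t <= b ->
    (variation_fun a w \- w) s <= (variation_fun a w \- w) t.
  move=> sa st tb; have := variation_fun_incr acw sa st tb.
  by move=> /(le_trans (ler_norm _)) /=; lra.
have [f [f0 intf fE]] := nondecreasing_abs_cont_density ab acF ndF.
have [g [g0 intg gE]] := nondecreasing_abs_cont_density ab acG ndG.
have fgi : mu.-integrable [set: R] (EFin \o (f \- g)).
  rewrite (_ : _ \o _ = (EFin \o f) \- (EFin \o g))%E; last exact/funext.
  exact: integrableB.
exists (f \- g) => // t /andP[ta tb].
rewrite -Rintegral_itv_obnd_cbnd; last exact: integrableS fgi.
rewrite RintegralB//; [|exact: integrableS intf|exact: integrableS intg].
rewrite /Rintegral fE// gE//=; lra.
Qed.

End abs_cont_density.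

(** * The derivative equals the density almost everywhere *)

Section abs_cont_derivative.
Context {R : realType}.
Local Notation mu := (@lebesgue_measure R).

Lemma derive1_density (a b : R) (w f : R -> R) :
  mu.-integrable [set: R] (EFin \o f) ->
  (forall t, a <= t <= b -> w t = w a + \int[mu]_(x in `[a, t]) f x) ->
  {ae mu, forall t, a < t < b -> derive1 w t = f t}.
Proof.
move=> fi wE.
have fl : locally_integrable setT f by exact: (open_integrable_locally openT fi).
have fy y : mu.-integrable `[a, y] (EFin \o f) by exact: integrableS fi.
have := FTC1 fy fl.
apply: filterS; first exact: (ae_filter_ringOfSetsType mu).
move=> t /= H /andP[a_t tb].
have {H} [|dF <-] := H; first by rewrite lte_fin.
have e : {near t, w =1 (cst (w a) \+ fun x => \int[mu]_(y in `[a, x]) f y)}.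
  near=> s; apply: wE; apply/andP; split; apply: ltW; near: s.
    exact: lt_nbhsr.
  exact: lt_nbhsl.
rewrite !derive1E (near_eq_derive _ e).
by rewrite deriveD// derive_cst add0r.
Unshelve. all: by end_near. Qed.

End abs_cont_derivative.

(** * Bounds on the Gamma function near zero *)

Section gamma_bounds.
Context {R : realType}.
Local Notation mu := (@lebesgue_measure R).

Lemma derivable_powR_gt0 (p t : R) : 0 < t -> derivable (@powR R ^~ p) t 1.
Proof. by move=> t0; apply: derivable_powR; rewrite in_itv/= t0. Qed.

Lemma within_continuous_powR (p c l : R) : 0 < c ->
  {within `[c, l], continuous (@powR R ^~ p)}.
Proof.
move=> c0; apply: derivable_within_continuous => t; rewrite in_itv/= => /andP[ct _].
exact/derivable_powR_gt0/(lt_le_trans c0).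
Qed.

Lemma integral_powR_itvcc (p c l : R) : 0 < p -> 0 < c -> c < l ->
  (\int[mu]_(t in `[c, l]) (t `^ (p - 1))%:E = ((l `^ p - c `^ p) / p)%:E)%E.
Proof.
move=> p0 c0 cl; pose F t : R := p^-1 * t `^ p.
have dF t : 0 < t -> derivable F t 1.
  by move=> t0; apply: derivableM => //; exact: derivable_powR_gt0.
rewrite (@continuous_FTC2 _ _ F)//.
- by rewrite -EFinB /F -mulrBr mulrC.
- exact: within_continuous_powR.
- have cF t : 0 < t -> {for t, continuous F}.
    by move=> t0; apply/differentiable_continuous/derivable1_diffP/dF.
  split.
  + by move=> t; rewrite in_itv/= => /andP[ct _]; exact/dF/(lt_trans c0).
  + by apply: cvg_at_right_filter; exact: cF.
  + by apply: cvg_at_left_filter; apply: cF; exact: lt_trans cl.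
- move=> t; rewrite in_itv/= => /andP[ct _].
  have t0 := lt_trans c0 ct.
  rewrite /F derive1Ml//; last exact: derivable_powR_gt0.
  by rewrite powR_derive1 ?in_itv/= ?t0// mulKf// gt_eqF.
Qed.

(** For [p < 1] the integrand is singular at [0], so the fundamental theorem is applied on
    [[1 / (n + 1), l]] and [n] tends to infinity. *)
Lemma integral_powR (p l : R) : 0 < p -> 0 < l ->
  (\int[mu]_(t in `]0%R, l]) (t `^ (p - 1))%:E = (l `^ p / p)%:E)%E.
Proof.
move=> p0 l0.
rewrite itv_open_bnd_bigcup.
pose F (n : nat) : set R := `[0 + n.+1%:R^-1, l]%classic.
have ndF : {homo F : n m / (n <= m)%N >-> (n <= m)%O}.
  move=> n m nm; apply/subsetPset => x; rewrite /F/= !in_itv/= !add0r => /andP[h ->].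
  by rewrite andbT (le_trans _ h)// lef_pV2 ?posrE// ler_nat.
have H := @ge0_nondecreasing_set_cvg_integral _ (measurableTypeR R) R F
  (fun t => (t `^ (p - 1))%:E) mu ndF.
apply: (cvg_unique _ (H _ _ _)) => //.
- by move=> i; exact: measurable_itv.
- by move=> n; apply: measurable_funTS; apply/measurable_EFinP; exact: measurable_powR.
- by move=> n x _; rewrite lee_fin powR_ge0.
apply: (@cvg_trans _ (((l `^ p - n.+1%:R^-1 `^ p) / p)%:E @[n --> \oo])).
  apply: near_eq_cvg; near=> n.
  rewrite /F add0r integral_powR_itvcc//.
  by near: n; exact: near_infty_natSinv_lt (PosNum l0).
apply: cvg_EFin; first by exact: nearW.
rewrite /comp/=; apply: cvgMl; rewrite -[X in _ --> X]subr0; apply: cvgB; first exact: cvg_cst.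
apply: (cvg_at_rightP _ _ _).1 (powR_cvg0 p0) _ _; split.
  by move=> n; rewrite invr_gt0 ltr0n.
exact: cvg_harmonic.
Unshelve. all: by end_near. Qed.

Lemma integral_expRN_le1 : (\int[mu]_(t in `]1%R, +oo[) (expR (- t))%:E <= 1)%E.
Proof.
rewrite -(integral_exponential_pdf (@ltr01 R)).
rewrite [leLHS]integral_mkcond; apply: ge0_le_integral => //.
- by move=> t _; rewrite patchE; case: ifPn => // _; rewrite lee_fin expR_ge0.
- apply/(measurable_restrictT _ _).1 => //.
  by apply/measurable_EFinP; apply: measurableT_comp => //; exact: measurableT_comp.
- by apply/measurable_EFinP; exact: measurable_exponential_pdf.
- move=> t _; rewrite patchE; case: ifPn => [|_]; last by rewrite lee_fin exponential_pdf_ge0.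
  rewrite inE/= in_itv/= andbT => t1.
  by rewrite exponential_pdfE ?mulN1r ?mul1r// (le_trans ler01)// ltW.
Qed.

Let gamma_fun (z t : R) := t `^ (z - 1) * expR (- t).

Let gamma_fun_ge0 z t : 0 <= gamma_fun z t.
Proof. by rewrite mulr_ge0// ?powR_ge0// expR_ge0. Qed.

Let measurable_gamma_fun z (D : set R) : measurable_fun D (EFin \o gamma_fun z).
Proof.
apply: measurable_funTS; apply/measurable_EFinP; apply: measurable_funM.
  exact: measurable_powR.
by apply: measurableT_comp => //; exact: measurableT_comp.
Qed.

Let Gamma_split (z : R) : (\int[mu]_(t in `]0%R, +oo[) (gamma_fun z t)%:E =
  \int[mu]_(t in `]0%R, 1%R]) (gamma_fun z t)%:E +
  \int[mu]_(t in `]1%R, +oo[) (gamma_fun z t)%:E)%E.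
Proof.
have -> : `]0%R, +oo[%classic = `]0%R, 1%R]%classic `|` `]1%R, +oo[%classic :> set R.
  apply/seteqP; split => x /=; rewrite !in_itv/= !andbT => h.
    by case: (leP x 1); [left; rewrite h|right].
  by case: h => [/andP[]//|]; exact: lt_trans.
rewrite ge0_integral_setU//; first exact: measurable_gamma_fun.
  by move=> t _; rewrite lee_fin.
apply/disj_set2P; rewrite -subset0 => x [] /=; rewrite !in_itv/= andbT => /andP[_].
by move=> /le_lt_trans h /h; rewrite ltxx.
Qed.

(** On []0, 1]] the factor [expR (- t)] lies between [expR (-1)] and [1], while the power integrates
    to [1 / z]; beyond [1] the power is at most [1]. The point is the size [1 / z] near [0]: it
    makes [1 / Gamma (1 - b)] vanish linearly as the order [b] tends to [1]. *)
Lemma Gamma_ge_le (z : R) : 0 < z -> z <= 1 ->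
  expR (-1) / z <= Gamma z /\ Gamma z <= z^-1 + 1.
Proof.
move=> z0 z1.
have I1 := integral_powR z0 (@ltr01 R).
rewrite powR1 div1r in I1.
have mp (D : set R) : measurable_fun D (EFin \o @powR R ^~ (z - 1)).
  by apply: measurable_funTS; apply/measurable_EFinP; exact: measurable_powR.
have ub1 : (\int[mu]_(t in `]0%R, 1%R]) (gamma_fun z t)%:E <= z^-1%:E)%E.
  rewrite -I1; apply: ge0_le_integral => //.
  + by move=> t _; rewrite lee_fin.
  + exact: measurable_gamma_fun.
  + exact: mp.
  + move=> t; rewrite /= in_itv/= => /andP[t0 _]; rewrite lee_fin ler_piMr ?powR_ge0//.
    by rewrite -expR0 ler_expR; lra.
have ub2 : (\int[mu]_(t in `]1%R, +oo[) (gamma_fun z t)%:E <= 1)%E.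
  apply: le_trans integral_expRN_le1; apply: ge0_le_integral => //.
  + by move=> t _; rewrite lee_fin.
  + exact: measurable_gamma_fun.
  + apply: measurable_funTS; apply/measurable_EFinP; apply: measurableT_comp => //.
  + move=> t; rewrite /= in_itv/= andbT => t1; rewrite lee_fin ler_piMl ?expR_ge0//.
    by rewrite -[leRHS](powRr0 t); apply: ler_powR; [exact: ltW|lra].
have lb1 : ((expR (-1) / z)%:E <= \int[mu]_(t in `]0%R, 1%R]) (gamma_fun z t)%:E)%E.
  rewrite EFinM -I1 -ge0_integralZl//; last 2 first.
  + exact: mp.
  + by move=> t _; rewrite lee_fin powR_ge0.
  apply: ge0_le_integral => //.
  + by move=> t _; rewrite -EFinM lee_fin mulr_ge0// ?powR_ge0// expR_ge0.
  + by apply: measurable_funeM; exact: mp.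
  + exact: measurable_gamma_fun.
  + move=> t; rewrite /= in_itv/= => /andP[t0 t1]; rewrite -EFinM lee_fin mulrC.
    by rewrite ler_pM2l ?powR_gt0// ler_expR; lra.
have lb2 : (0 <= \int[mu]_(t in `]1%R, +oo[) (gamma_fun z t)%:E)%E.
  by apply: integral_ge0 => t _; rewrite lee_fin.
have : (\int[mu]_(t in `]0%R, +oo[) (gamma_fun z t)%:E)%E \is a fin_num.
  rewrite Gamma_split fin_numD !ge0_fin_numE//.
    by rewrite (le_lt_trans ub1 (ltry _)) (le_lt_trans ub2 (ltry _)).
  by apply: integral_ge0 => t _; rewrite lee_fin.
move=> /fineK; rewrite -/(Gamma z) => GE.
rewrite -!lee_fin GE Gamma_split EFinD; split; last exact: leeD.
by apply: (le_trans lb1); rewrite leeDl.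
Qed.

End gamma_bounds.

(** * Tonelli and Fubini for real functions of two variables *)

Section real_fubini.
Context {R : realType}.
Local Notation mu := (@lebesgue_measure R).
Implicit Types g : R -> R -> R.

Lemma ae_imp (P Q : R -> Prop) : (forall x, P x -> Q x) ->
  {ae mu, forall x, P x} -> {ae mu, forall x, Q x}.
Proof.
by move=> PQ; apply: filterS => //; exact: (ae_filter_ringOfSetsType mu).
Qed.

Lemma ae_and (P Q : R -> Prop) : {ae mu, forall x, P x} ->
  {ae mu, forall x, Q x} -> {ae mu, forall x, P x /\ Q x}.
Proof.
by move=> aP aQ; apply: filterI => //; exact: (ae_filter_ringOfSetsType mu).
Qed.

Lemma ae_neq (c : R) : {ae mu, forall x, x != c}.
Proof.
exists [set c]; split => //; first exact: lebesgue_measure_set1.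
by move=> x /= /negP; rewrite negbK => /eqP.
Qed.

Definition measurable_fun2 g := measurable_fun [set: R * R] (fun z => g z.1 z.2).

Definition integrable_fun (f : R -> R) := mu.-integrable [set: R] (EFin \o f).

Lemma measurable_fun2_EFin g : measurable_fun2 g ->
  measurable_fun [set: measurableTypeR R * measurableTypeR R]
    (fun z => (g z.1 z.2)%:E).
Proof. by move=> mg; apply/measurable_EFinP. Qed.

Lemma measurable_fun2_swap g : measurable_fun2 g ->
  measurable_fun2 (fun x y => g y x).
Proof.
by move=> mg; exact: (measurableT_comp mg (@measurable_swap _ _ R R)).
Qed.

Lemma real_tonelli g : measurable_fun2 g -> (forall x y, 0 <= g x y) ->
  (\int[mu]_x \int[mu]_y (g x y)%:E = \int[mu]_y \int[mu]_x (g x y)%:E)%E.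
Proof.
move=> /measurable_fun2_EFin mg g0.
have g0' z : (0 <= (fun z => (g z.1 z.2)%:E) z)%E by rewrite lee_fin.
exact: (fubini_tonelli (m1 := mu) (m2 := mu) (fun z => (g z.1 z.2)%:E) mg g0').
Qed.

Lemma measurable_tonelli g : measurable_fun2 g -> (forall x y, 0 <= g x y) ->
  measurable_fun [set: R] (fun x => (\int[mu]_y (g x y)%:E)%E).
Proof.
move=> /measurable_fun2_EFin mg g0.
have g0' z : (0 <= (fun z => (g z.1 z.2)%:E) z)%E by rewrite lee_fin.
exact: (measurable_fun_fubini_tonelli_F (m2 := mu) (fun z => (g z.1 z.2)%:E) mg g0').
Qed.

Let half_fubini g : measurable_fun2 g ->
  (\int[mu]_x \int[mu]_y `|g x y|%:E < +oo)%E ->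
  [/\ {ae mu, forall x, integrable_fun (g x)},
      integrable_fun (fun x => \int[mu]_y g x y) &
      ((\int[mu]_x \int[mu]_y g x y)%R%:E = \int[mu]_x \int[mu]_y (g x y)%:E)%E].
Proof.
move=> mg' ig; have mg := measurable_fun2_EFin mg'.
have ig2 := (integrable12ltyP mu mu mg).2 ig.
have ae1 := ae_integrable1 ig2.
have intF := integrable_fubini_F ig2.
(* The inner integral is known to be finite only for almost every [x]; elsewhere [fine] may change
   it. *)
have aeF : ae_eq mu [set: R] (fubini_F mu (fun z => (g z.1 z.2)%:E))
    (fun x => (\int[mu]_y g x y)%:E).
  by apply: ae_imp ae1 => x ix _; rewrite /fubini_F/= fineK//; exact: integrable_fin_num ix.
have mF := measurable_int _ intF.
have mH : measurable_fun [set: R] (fun x => (\int[mu]_y g x y)%:E).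
  apply/measurable_EFinP.
  exact: (measurableT_comp (@fine_measurable R [set: \bar R] measurableT) mF).
have eqF : (\int[mu]_x (\int[mu]_y g x y)%R%:E = \int[mu]_x \int[mu]_y (g x y)%:E)%E.
  by apply/esym; exact: ae_eq_integral.
have iH : integrable_fun (fun x => \int[mu]_y g x y).
  apply/integrableP; split => //.
  have /integrableP[_] := intF; apply: le_lt_trans.
  rewrite le_eqVlt; apply/orP; left; apply/eqP; apply: ae_eq_integral => //.
  + by apply: measurableT_comp mH.
  + by apply: measurableT_comp mF.
  + by apply: ae_imp aeF => x h xT; exact: (congr1 abse (esym (h xT))).
split => //.
by rewrite /Rintegral fineK ?eqF//; rewrite -eqF; exact: integrable_fin_num iH.
Qed.

Lemma real_fubini g : measurable_fun2 g ->
  (\int[mu]_x \int[mu]_y `|g x y|%:E < +oo)%E ->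
  [/\ {ae mu, forall x, integrable_fun (g x)},
      {ae mu, forall y, integrable_fun (g ^~ y)},
      integrable_fun (fun x => \int[mu]_y g x y),
      integrable_fun (fun y => \int[mu]_x g x y) &
      \int[mu]_x \int[mu]_y g x y = \int[mu]_y \int[mu]_x g x y].
Proof.
move=> mg ig; have mgs := measurable_fun2_swap mg.
have mgn : measurable_fun2 (fun x y => `|g x y|) by exact: measurableT_comp.
have igs : (\int[mu]_y \int[mu]_x `|g x y|%:E < +oo)%E by rewrite -real_tonelli.
have [a1 i1 e1] := half_fubini mg ig.
have [a2 i2 e2] := half_fubini mgs igs.
split => //; apply: EFin_inj; rewrite e1 e2.
have ig2 := (integrable12ltyP mu mu (measurable_fun2_EFin mg)).2 ig.
exact: (Fubini ig2).
Qed.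

End real_fubini.

(** * Translations and reflections preserve Lebesgue integrals *)

Section isometries.
Context {R : realType}.
Local Notation mu := (@lebesgue_measure R).

Definition measure_preserving (phi : R -> R) := measurable_fun [set: R] phi /\
  forall A : set R, measurable A -> mu (phi @^-1` A) = mu A.

Lemma measure_preserving_shift c : measure_preserving (fun x => x + c).
Proof.
have mphi : measurable_fun [set: R] (fun x => x + c) by exact: measurable_funD.
split => // A mA; apply/esym.
pose phi : measurableTypeR R -> measurableTypeR R := fun x => x + c.
rewrite -[RHS]/(pushforward mu phi A); apply: lebesgue_measure_unique => //= _ [[a b]] _ <-.
rewrite /pushforward (_ : _ @^-1` _ = `]a - c, b - c]%classic); last first.
  by apply/seteqP; split => x /=; rewrite !in_itv/= ltrBlDr lerBrDr.
by rewrite !lebesgue_measure_itv/= !lte_fin ltrD2r -!EFinB; case: ifP => // _; congr EFin; lra.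
Qed.

Lemma measure_preserving_comp phi1 phi2 : measure_preserving phi1 ->
  measure_preserving phi2 -> measure_preserving (phi1 \o phi2).
Proof.
move=> [m1 p1] [m2 p2]; split; first exact: measurableT_comp.
move=> A mA; rewrite comp_preimage p2 ?p1//.
by rewrite -[X in measurable X]setTI; exact: m1.
Qed.

Lemma measure_preserving_opp : measure_preserving -%R.
Proof. by split => // A mA; exact: lebesgue_measureN. Qed.

Lemma measure_preserving_sub c : measure_preserving (fun x => c - x).
Proof.
have -> : (fun x => c - x) = (fun x => x + c) \o -%R by apply/funext => x /=; rewrite addrC.
exact: measure_preserving_comp (measure_preserving_shift c) measure_preserving_opp.
Qed.

Variables (phi : R -> R) (mp : measure_preserving phi).

Lemma ge0_integral_preserving (h : R -> \bar R) : measurable_fun [set: R] h ->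
  (forall x, 0 <= h x)%E -> (\int[mu]_x h (phi x) = \int[mu]_x h x)%E.
Proof.
move=> mh h0; have [mphi pphi] := mp.
pose psi : measurableTypeR R -> measurableTypeR R := phi.
have := @ge0_integral_pushforward _ _ (measurableTypeR R) (measurableTypeR R) R psi
  mphi mu [set: R] h measurableT mh (fun x _ => h0 x).
rewrite preimage_setT => /= <-; apply: eq_measure_integral => A mA _.
exact: pphi.
Qed.

Lemma integrable_preserving (f : R -> R) : integrable_fun f ->
  integrable_fun (f \o phi).
Proof.
move=> /integrableP[mf intf]; have [mphi pphi] := mp.
apply/integrableP; split; first exact: (measurableT_comp mf mphi).
have e : (\int[mu]_x `|(EFin \o (f \o phi)) x| = \int[mu]_x `|(EFin \o f) x|)%E.
  by apply: (@ge0_integral_preserving (fun x => `|(f x)%:E|%E)); first exact: measurableT_comp mf.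
by rewrite e.
Qed.

Lemma Rintegral_preserving (f : R -> R) : measurable_fun [set: R] f ->
  \int[mu]_x f (phi x) = \int[mu]_x f x.
Proof.
move=> /measurable_EFinP mf.
rewrite /Rintegral; congr fine; rewrite integralE [RHS]integralE.
have ep := @ge0_integral_preserving ((EFin \o f)^\+)%E (measurable_funepos mf) (funepos_ge0 _).
have en := @ge0_integral_preserving ((EFin \o f)^\-)%E (measurable_funeneg mf) (funeneg_ge0 _).
rewrite -[RHS]/(\int[mu]_x (EFin \o f)^\+ x - \int[mu]_x (EFin \o f)^\- x)%E -ep -en.
by congr (_ - _)%E; apply: eq_integral => x _; rewrite ?funeposE ?funenegE.
Qed.

End isometries.

(** * Convolution of integrable functions *)

Section convolution.
Context {R : realType}.
Local Notation mu := (@lebesgue_measure R).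
Implicit Types (f g : R -> R).

Lemma integrable_fun_measurable f : integrable_fun f -> measurable_fun [set: R] f.
Proof. by move=> /measurable_int/measurable_EFinP. Qed.

Lemma measurable_fun2_comp f (phi : R -> R -> R) : measurable_fun [set: R] f ->
  measurable_fun2 phi -> measurable_fun2 (fun x y => f (phi x y)).
Proof. by move=> mf mphi; exact: (measurableT_comp mf mphi). Qed.

Lemma measurable_fun2_fst : measurable_fun2 (fun x _ : R => x).
Proof. exact: measurable_fst. Qed.

Lemma measurable_fun2_snd : measurable_fun2 (fun _ y : R => y).
Proof. exact: measurable_snd. Qed.

Lemma measurable_fun2D (p q : R -> R -> R) : measurable_fun2 p -> measurable_fun2 q ->
  measurable_fun2 (fun x y => p x y + q x y).
Proof. by move=> mp mq; exact: measurable_funD. Qed.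

Lemma measurable_fun2B (p q : R -> R -> R) : measurable_fun2 p -> measurable_fun2 q ->
  measurable_fun2 (fun x y => p x y - q x y).
Proof. by move=> mp mq; exact: measurable_funB. Qed.

Lemma measurable_fun2M (p q : R -> R -> R) : measurable_fun2 p -> measurable_fun2 q ->
  measurable_fun2 (fun x y => p x y * q x y).
Proof. by move=> mp mq; exact: measurable_funM. Qed.

Lemma Rintegral_indic (D : set R) f :
  \int[mu]_(x in D) f x = \int[mu]_x (\1_D x * f x).
Proof.
rewrite Rintegral_mkcond; apply: eq_Rintegral => x _.
by rewrite patchE indicE; case: ifPn => _; rewrite ?mul1r ?mul0r.
Qed.

Lemma integrable_fun_indic (D : set R) f : measurable D -> integrable_fun f ->
  integrable_fun (fun x => \1_D x * f x).
Proof.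
move=> mD intf; have mf := integrable_fun_measurable intf.
apply: le_integrable intf => //.
  by apply/measurable_EFinP; apply: measurable_funM => //; exact: measurable_indic.
move=> x _ /=; rewrite lee_fin normrM indicE ler_piMl//.
by case: (x \in D); rewrite ?normr1 ?normr0.
Qed.

Lemma measurable_fun2_slice1 (p : R -> R -> R) x : measurable_fun2 p ->
  measurable_fun [set: R] (p x).
Proof. by move=> mp; exact: (measurableT_comp mp (pair1_measurable x)). Qed.

Variables (kap f : R -> R).
Hypotheses (intk : integrable_fun kap) (k0 : forall x, 0 <= kap x)
  (intf : integrable_fun f).

Let mk := integrable_fun_measurable intk.
Let mf := integrable_fun_measurable intf.

Definition conv s := \int[mu]_r (kap (s - r) * f r).

Let mconv : measurable_fun2 (fun s r => kap (s - r) * f r).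
Proof.
apply: measurable_fun2M; last exact: measurable_fun2_comp mf measurable_fun2_snd.
apply: measurable_fun2_comp => //.
by apply: measurable_fun2B; [exact: measurable_fun2_fst|exact: measurable_fun2_snd].
Qed.

(** By Tonelli and translation invariance the double integral is the product of the integrals of
    [|f|] and of [kap]. *)
Let conv_lty : (\int[mu]_s \int[mu]_r `|kap (s - r) * f r|%:E < +oo)%E.
Proof.
rewrite (@real_tonelli _ (fun s r => `|kap (s - r) * f r|))//; last exact: measurableT_comp.
have H r : (\int[mu]_s `|kap (s - r) * f r|%:E = `|f r|%:E * \int[mu]_s (kap s)%:E)%E.
  under eq_integral do rewrite normrM (ger0_norm (k0 _)) mulrC EFinM.
  rewrite ge0_integralZl//.
  - congr (_ * _)%E.
    have := @ge0_integral_preserving R _ (measure_preserving_shift (- r)) (EFin \o kap).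
    by apply => //; exact/measurable_EFinP.
  - apply/measurable_EFinP; apply: measurableT_comp => //.
    exact: measurable_funB.
  - by move=> x _; rewrite lee_fin.
under eq_integral do rewrite H.
have If : (\int[mu]_r `|f r|%:E)%E \is a fin_num.
  rewrite ge0_fin_numE; first by move/integrableP: intf => [].
  by apply: integral_ge0 => x _; rewrite lee_fin.
have Ik : (\int[mu]_s (kap s)%:E)%E \is a fin_num by exact: integrable_fin_num intk.
rewrite ge0_integralZr//.
- by rewrite -(fineK If) -(fineK Ik) -EFinM ltry.
- by apply/measurable_EFinP; exact: measurableT_comp.
- by apply: integral_ge0 => x _; rewrite lee_fin.
Qed.

Lemma conv_ae_integrable : {ae mu, forall s, integrable_fun (fun r => kap (s - r) * f r)}.
Proof. by have [] := real_fubini mconv conv_lty. Qed.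

Lemma integrable_conv : integrable_fun conv.
Proof. by have [] := real_fubini mconv conv_lty. Qed.

(** Averaging commutes with convolution. Shifting [r] by [s - t] turns [kap (s - r)] into
    [kap (t - r)], which is free of [s]; after exchanging the integrals, [r + (s - t)] runs through
    [[r - h, r]]. *)
Lemma Rintegral_conv_window (t h : R) : 0 <= h ->
  \int[mu]_(s in `[t - h, t]) conv s =
  \int[mu]_r (kap (t - r) * \int[mu]_(s in `[r - h, r]) f s).
Proof.
move=> h0; pose D : set R := `[t - h, t]%classic.
have DE (y x : R) : (x \in D) = (x + (y - t) \in `[y - h, y]%classic).
  by rewrite /D; apply/idP/idP; rewrite !inE/= !in_itv/= => /andP[? ?]; apply/andP; split; lra.
have mD : measurable D by exact: measurable_itv.
pose g s r : R := \1_D s * (kap (t - r) * f (r + (s - t))).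
have mi : measurable_fun [set: R] (\1_D : R -> R) by exact: measurable_indic.
have mg : measurable_fun2 g.
  apply: measurable_fun2M; first exact: (measurable_fun2_comp mi measurable_fun2_fst).
  apply: measurable_fun2M; apply: measurable_fun2_comp => //.
    by apply: measurable_fun2B; [exact: measurable_cst|exact: measurable_fun2_snd].
  apply: measurable_fun2D; first exact: measurable_fun2_snd.
  by apply: measurable_fun2B; [exact: measurable_fun2_fst|exact: measurable_cst].
have shiftE s r : kap (t - r) * f (r + (s - t)) =
    (fun r => kap (s - r) * f r) (r + (s - t)).
  by congr (kap _ * _); lra.
have msh s : measurable_fun [set: R] (fun r => kap (s - (r + (s - t))) * f (r + (s - t))).
  exact: (measurableT_comp (measurable_fun2_slice1 s mconv) (measure_preserving_shift (s - t)).1).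
have glty : (\int[mu]_s \int[mu]_r `|g s r|%:E < +oo)%E.
  apply: le_lt_trans conv_lty; apply: ge0_le_integral => //.
  - by move=> s _; apply: integral_ge0 => r _; rewrite lee_fin.
  - by apply: measurable_tonelli => //; exact: measurableT_comp.
  - apply: (@measurable_tonelli _ (fun s r => `|kap (s - r) * f r|)) => //.
    exact: measurableT_comp.
  - move=> s _.
    rewrite -(ge0_integral_preserving (measure_preserving_shift (s - t))
      (h := fun r => `|kap (s - r) * f r|%:E))//; last first.
      by apply/measurable_EFinP; apply: measurableT_comp => //; exact: measurable_fun2_slice1 mconv.
    apply: ge0_le_integral => //.
    + apply/measurable_EFinP; apply: measurableT_comp => //; exact: measurable_fun2_slice1 mg.
    + by apply/measurable_EFinP; apply: measurableT_comp (msh s).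
    + move=> r _; rewrite lee_fin /g shiftE normrM indicE ler_piMl//.
      by case: (s \in D); rewrite ?normr1 ?normr0.
have [_ _ _ _ e] := real_fubini mg glty.
rewrite Rintegral_indic -/D.
transitivity (\int[mu]_s \int[mu]_r g s r).
  apply: eq_Rintegral => s _.
  rewrite /conv -(Rintegral_preserving (measure_preserving_shift (s - t)))/=; last first.
    exact: measurable_fun2_slice1 mconv.
  rewrite /g indicE; case: (s \in D); last first.
    by under [RHS]eq_Rintegral do rewrite mul0r; rewrite mul0r Rintegral_cst// mul0r.
  by rewrite mul1r; apply: eq_Rintegral => r _; rewrite mul1r shiftE.
rewrite e; apply: eq_Rintegral => r _.
have mI : measurable (`[r - h, r]%classic : set R) by exact: measurable_itv.
have intI := integrable_fun_indic mI intf.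
rewrite [X in _ = _ * X]Rintegral_indic.
rewrite -[X in _ = _ * X](Rintegral_preserving (measure_preserving_shift (r - t)))/=; last first.
  exact: integrable_fun_measurable.
rewrite -RintegralZl//; last exact: (integrable_preserving (measure_preserving_shift (r - t)) intI).
apply: eq_Rintegral => s _; rewrite /g mulrCA; congr (_ * (_ * f _)); last by lra.
by rewrite !indicE (DE r).
Qed.

End convolution.

(** * Lower bound for a convolution with a monotone kernel *)

Section monotone_kernel.
Context {R : realType}.
Local Notation mu := (@lebesgue_measure R).
Variables (kap v : R -> R) (t p l m B : R).
Hypotheses (intk : integrable_fun kap) (k0 : forall x, 0 <= kap x)
  (kmon : forall x y, 0 < x -> x <= y -> y <= l -> kap y <= kap x)
  (ksupp : forall x, 0 < kap x -> 0 < x <= l)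
  (mv : measurable_fun [set: R] v) (vB : forall x, `|v x| <= B)
  (tail_ge0 : forall s, s <= t -> 0 <= \int[mu]_(r in `[s, t]) v r)
  (tail_ge : forall s, s <= p -> m <= \int[mu]_(r in `[s, t]) v r).

(** Indicator of the region under the graph of [r |-> kap (t - r)]: its integral in [y] is
    [kap (t - r)]. *)
Let chi (r y : R) : R := if (0 <= y) && (y < kap (t - r)) then 1 else 0.

Let g r y := chi r y * v r.

Let mk := integrable_fun_measurable intk.

Let intkt : integrable_fun (fun r => kap (t - r)).
Proof. exact: (integrable_preserving (measure_preserving_sub t) intk). Qed.

Let mchi : measurable_fun2 chi.
Proof.
apply: measurable_fun_ifT => //; apply: measurable_and.
  by apply: measurable_fun_ler => //; exact: measurable_fun2_snd.
apply: measurable_fun_ltr; first exact: measurable_fun2_snd.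
exact: (measurable_fun2_comp (integrable_fun_measurable intkt) measurable_fun2_fst).
Qed.

Let mg : measurable_fun2 g.
Proof. by apply: measurable_fun2M => //; exact: (measurable_fun2_comp mv measurable_fun2_fst). Qed.

Lemma integral_cut (c : R) : 0 <= c ->
  (\int[mu]_y (if (0 <= y) && (y < c) then 1 else 0 : R)%:E = c%:E)%E.
Proof.
move=> c0.
transitivity (\int[mu]_y (\1_(`[0%R, c[%classic : set R) y)%:E)%E.
  apply: eq_integral => y _; rewrite indicE; congr (_%:E).
  rewrite (_ : (y \in _) = (0 <= y) && (y < c)); last by rewrite mem_setE in_itv.
  by case: ifP.
rewrite integral_indic ?setIT; [|exact: measurableT|exact: measurable_itv].
rewrite /= lebesgue_measure_itv/= lte_fin; case: ltP => [_|cle0]; first by rewrite sube0.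
by congr EFin; apply/eqP; rewrite eq_le c0.
Qed.

Let intchi r : integrable_fun (chi r).
Proof.
apply/integrableP; split.
  by apply/measurable_EFinP; exact: measurable_fun2_slice1 mchi.
have -> : (\int[mu]_y `|(EFin \o chi r) y| = (kap (t - r))%:E)%E.
  rewrite -(integral_cut (k0 (t - r))); apply: eq_integral => y _ /=.
  by rewrite ger0_norm// /chi; case: ifP.
exact: ltry.
Qed.

Let slice_y r : \int[mu]_y g r y = kap (t - r) * v r.
Proof.
rewrite /g RintegralZr//; last exact: intchi.
by rewrite /Rintegral /chi integral_cut.
Qed.

Let glty : (\int[mu]_r \int[mu]_y `|g r y|%:E < +oo)%E.
Proof.
have E r : (\int[mu]_y `|g r y|%:E = (kap (t - r) * `|v r|)%:E)%E.
  rewrite EFinM -(integral_cut (k0 (t - r))) -ge0_integralZr//.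
  - apply: eq_integral => y _; rewrite /g normrM -EFinM; congr (_ * _)%:E.
    by rewrite ger0_norm// /chi; case: ifP.
  - by apply/measurable_EFinP; exact: measurable_fun2_slice1 mchi.
  - by move=> y _; case: ifP; rewrite lee_fin.
under eq_integral do rewrite E.
have intkB : integrable_fun (fun r => B * kap (t - r)).
  rewrite /integrable_fun (_ : _ \o _ = (fun r => B%:E * (kap (t - r))%:E)%E)//.
  exact: integrableZl.
have /integrableP[_] := intkB; apply: le_lt_trans; apply: ge0_le_integral => //.
- by move=> r _; rewrite lee_fin mulr_ge0.
- apply/measurable_EFinP; apply: measurable_funM; last exact: measurableT_comp.
  exact: integrable_fun_measurable.
- by apply/measurable_EFinP; apply: measurableT_comp => //; exact: integrable_fun_measurable.
- move=> r _; rewrite lee_fin mulrC ler_normr ler_wpM2r//=; exact: le_trans (vB _).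
Qed.

Let intv s : mu.-integrable `[s, t] (EFin \o v).
Proof.
apply: measurable_bounded_integrable => //.
- by rewrite /= lebesgue_measure_itv/=; case: ifP => // _; rewrite -EFinD ltry.
- exact: measurable_funTS.
- exists B; split; first by rewrite num_real.
  by move=> x Bx y _ /=; exact: le_trans (vB y) (ltW Bx).
Qed.

(* The superlevel sets of [r |-> kap (t - r)] are intervals ending at [t]: the layer-cake
   formula reduces the claim to integrals of [v] over such intervals. *)
Let slice_r y : 0 <= y -> (forall r, y < kap (t - r) -> False) \/
  exists2 s, s <= t /\ (y < kap (t - p) -> s <= p) &
  \int[mu]_r g r y = \int[mu]_(r in `[s, t]) v r.
Proof.
move=> y0; have [[r0 Er0]|nE] := pselect (exists r, y < kap (t - r)); last first.
  by left => r yr; apply: nE; exists r.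
right; pose E : set R := [set r | y < kap (t - r)].
have Et r : E r -> r < t.
  by move=> Er; have /andP[] := ksupp (le_lt_trans y0 Er); rewrite subr_gt0.
have Eup r r' : E r -> r <= r' -> r' < t -> E r'.
  move=> Er rr' r't; rewrite /E/= (lt_le_trans Er)//; apply: kmon; [lra|lra|].
  by have /andP[] := ksupp (le_lt_trans y0 Er).
have Elb : has_lbound E.
  exists (t - l) => r Er.
  by have /andP[_] := ksupp (le_lt_trans y0 Er); lra.
have E0 : E !=set0 by exists r0.
have hE : has_inf E by split.
exists (inf E).
  split; first by apply: (le_trans (ge_inf Elb Er0)); apply: ltW; exact: Et.
  by move=> Ep; exact: ge_inf.
have infE r : inf E < r -> r < t -> E r.
  by move=> /(inf_lt E0)[r' Er' r'r] rt; exact: Eup Er' (ltW r'r) rt.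
transitivity (\int[mu]_(r in E) v r).
  rewrite [RHS]Rintegral_mkcond; apply: eq_Rintegral => r _.
  rewrite /g /chi y0 patchE /=.
  have -> : (r \in E) = (y < kap (t - r)) by apply/idP/idP; rewrite inE.
  by case: ifP => _; rewrite ?mul1r ?mul0r.
have [Ei|nEi] := pselect (E (inf E)).
  have EE : E = `[inf E, t[%classic.
    apply/seteqP; split => r /=; rewrite in_itv/=.
      by move=> Er; rewrite (ge_inf Elb Er) Et.
    by move=> /andP[ir rt]; exact: Eup Ei ir rt.
  rewrite [in LHS]EE Rintegral_itv_bndo_bndc//; apply: integrableS (intv (inf E)) => //.
  by move=> r/=; rewrite !in_itv/= => /andP[-> /ltW].
have EE : E = `]inf E, t[%classic.
  apply/seteqP; split => r /=; rewrite in_itv/=.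
    move=> Er; rewrite Et// andbT lt_neqAle (ge_inf Elb Er) andbT.
    by apply/eqP => rE; apply: nEi; rewrite rE.
  by move=> /andP[ir rt]; exact: infE.
rewrite [in LHS]EE Rintegral_itv_bndo_bndc ?Rintegral_itv_obnd_cbnd//.
- apply: integrableS (intv (inf E)) => //.
  by move=> r/=; rewrite !in_itv/= => /andP[/ltW -> ->].
- apply: integrableS (intv (inf E)) => //.
  by move=> r/=; rewrite !in_itv/= => /andP[/ltW -> /ltW].
Qed.

(** A level [y] below [kap (t - p)] has a superlevel interval reaching left to [p] or further, so
    its slice contributes at least [m]; every other level contributes at least [0]. Integrate over
    [y]. *)
Lemma monotone_kernel_ge : kap (t - p) * m <= \int[mu]_r (kap (t - r) * v r).
Proof.
have [_ _ _ intG e] := real_fubini mg glty.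
under [leRHS]eq_Rintegral do rewrite -slice_y.
rewrite e.
have intc : integrable_fun (fun y => chi p y * m).
  rewrite /integrable_fun (_ : _ \o _ = (fun y => (chi p y)%:E * m%:E)%E)//.
  by apply: integrableZr => //; exact: intchi.
have -> : kap (t - p) * m = \int[mu]_y (chi p y * m).
  by rewrite RintegralZr//; [rewrite /Rintegral /chi integral_cut|exact: intchi].
apply: le_Rintegral => // y _.
have g0 : (forall r, chi r y = 0) -> \int[mu]_r g r y = 0.
  move=> H; under eq_Rintegral do rewrite /g H mul0r.
  by rewrite Rintegral_cst// mul0r.
have [y0|y0] := leP 0 y; last first.
  have H r : chi r y = 0 by rewrite /chi leNgt y0.
  by rewrite g0// H mul0r.
have [H|[s [st sp] ->]] := slice_r y0.
  have H' r : chi r y = 0 by rewrite /chi y0/=; case: ifP => // /H.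
  by rewrite g0// H' mul0r.
rewrite /chi y0/=; case: ifP => [/sp/tail_ge|_]; first by rewrite mul1r.
by rewrite mul0r tail_ge0.
Qed.

End monotone_kernel.

(** * The kernel obtained by mixing powers of different orders *)

Section kernel.
Context {R : realType}.
Local Notation mu := (@lebesgue_measure R).
Variables (c : R -> R) (C b1 b2 e : R).
Hypotheses (mc : measurable_fun [set: R] c) (c0 : forall b, 0 <= c b)
  (cC : forall b : R, 0 <= b -> b < 1 -> c b <= C * (1 - b))
  (csupp : forall b : R, ~~ (0 <= b < 1) -> c b = 0)
  (b12 : b1 < b2) (e0 : 0 < e)
  (ce : forall b, b1 <= b -> b <= b2 -> e <= c b).

Let indic_co (x y z : R) : \1_(`[x, y[%classic : set R) z = (x <= z < y)%R%:R :> R.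
Proof. by rewrite indicE mem_setE in_itv. Qed.

Let indic_cc (x y z : R) : \1_(`[x, y]%classic : set R) z = (x <= z <= y)%R%:R :> R.
Proof. by rewrite indicE mem_setE in_itv. Qed.

Let indic_oc (x y z : R) : \1_(`]x, y]%classic : set R) z = (x < z <= y)%R%:R :> R.
Proof. by rewrite indicE mem_setE in_itv. Qed.

(** The power [u^-b] extended by [0] to [u <= 0], which makes the kernel causal. The form with
    [expR] and [ln] makes joint measurability in [(b, u)] immediate. *)
Definition kpow (b u : R) : R := if 0 < u then expR (- b * ln u) else 0.

Definition kern (u : R) := \int[mu]_b (c b * kpow b u).

Lemma kpow_ge0 b u : 0 <= kpow b u.
Proof. by rewrite /kpow; case: ifP => // _; exact: expR_ge0. Qed.

Lemma kpow_powR b u : 0 < u -> kpow b u = u `^ (- b).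
Proof. by move=> u0; rewrite /kpow u0 /powR gt_eqF. Qed.

Lemma kpow_le b u : 0 <= b -> b <= 1 -> 0 < u -> kpow b u <= 1 + u^-1.
Proof.
move=> b0 bl1 u0; rewrite kpow_powR//; have ui0 : 0 <= u^-1 by rewrite invr_ge0 ltW.
have [u1|u1] := leP 1 u.
  apply: (@le_trans _ _ 1); last by rewrite lerDl.
  by rewrite -[leRHS](powRr0 u) ler_powR//; lra.
apply: (@le_trans _ _ (u^-1)); last by rewrite lerDr.
by rewrite -powR_inv1 ?(ltW u0)// ger_powR ?u0 ?(ltW u1)//; lra.
Qed.

Lemma kpow_nonincreasing b u v : 0 <= b -> 0 < u -> u <= v -> kpow b v <= kpow b u.
Proof.
move=> b0 u0 uv; rewrite /kpow u0 (lt_le_trans u0 uv) ler_expR.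
by rewrite !mulNr lerN2 ler_wpM2l// ler_ln// posrE (lt_le_trans u0).
Qed.

Lemma measurable_kpow : measurable_fun2 kpow.
Proof.
apply: measurable_fun_ifT => //.
  by apply: measurable_fun_ltr => //; exact: measurable_fun2_snd.
apply: measurableT_comp => //; apply: measurable_funM.
  by apply: measurableT_comp => //; exact: measurable_fun2_fst.
by apply: measurableT_comp => //; exact: measurable_fun2_snd.
Qed.

Let mckpow : measurable_fun2 (fun u b => c b * kpow b u).
Proof.
apply: measurable_fun2M; first exact: (measurable_fun2_comp mc measurable_fun2_snd).
exact: (measurable_fun2_swap measurable_kpow).
Qed.

Let C0 : 0 <= C.
Proof. by have := le_trans (c0 0) (cC (lexx _) ltr01); rewrite subr0 mulr1. Qed.

Let ckpow_ge0 b u : 0 <= c b * kpow b u.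
Proof. by rewrite mulr_ge0// kpow_ge0. Qed.

Let integrable_unit (r : R) : integrable_fun (fun b => \1_(`[0, 1[%classic : set R) b * r).
Proof.
have mI : measurable (`[0, 1[%classic : set R) by exact: measurable_itv.
rewrite /integrable_fun (_ : _ \o _ = (fun b => (\1_(`[0, 1[%classic : set R) b)%:E * r%:E)%E)//.
apply: integrableZr => //; exact: integrable_indic_itv.
Qed.

Lemma integrable_ckpow u : integrable_fun (fun b => c b * kpow b u).
Proof.
have [u0|u0] := ltP 0 u; last first.
  rewrite /integrable_fun (_ : _ \o _ = cst 0%E); first exact: integrable0.
  by apply/funext => b /=; rewrite /kpow ltNge u0 mulr0.
apply: le_integrable (integrable_unit (C * (1 + u^-1))) => //.
  by apply/measurable_EFinP; exact: measurable_fun2_slice1 mckpow.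
move=> b _ /=; rewrite lee_fin [leLHS]ger0_norm// (le_trans _ (ler_norm _))//.
rewrite indic_co; case: (boolP (0 <= b < 1)) => [/andP[bge blt]|nb].
  rewrite mul1r.
  apply: ler_pM => //; first exact: kpow_ge0.
    apply: (le_trans (cC bge blt)); rewrite ler_piMr//; lra.
  by apply: kpow_le => //; exact: ltW.
by rewrite csupp// !mul0r.
Qed.

Lemma kern_ge0 u : 0 <= kern u.
Proof. by apply: Rintegral_ge0 => b _. Qed.

Lemma kern_le0 u : u <= 0 -> kern u = 0.
Proof.
move=> u0; rewrite /kern.
under eq_Rintegral do rewrite /kpow ltNge u0 mulr0.
by rewrite Rintegral_cst// mul0r.
Qed.

Lemma kern_nonincreasing u v : 0 < u -> u <= v -> kern v <= kern u.
Proof.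
move=> u0 uv; apply: le_Rintegral => //; [exact: integrable_ckpow..|move=> b _].
have [/andP[bge _]|nb] := boolP (0 <= b < 1); last by rewrite csupp// !mul0r.
by rewrite ler_wpM2l// kpow_nonincreasing.
Qed.

Lemma kernE u : (\int[mu]_b (c b * kpow b u)%:E)%E = (kern u)%:E.
Proof. by rewrite /kern fineK//; exact: integrable_fin_num (integrable_ckpow u). Qed.

Lemma measurable_kern : measurable_fun [set: R] kern.
Proof.
apply/measurable_EFinP; rewrite (_ : EFin \o kern = fun u => (\int[mu]_b (c b * kpow b u)%:E)%E).
  exact: measurable_tonelli mckpow _.
by apply/funext => u; rewrite kernE.
Qed.

(** Only the orders in [[b1, b2]] are kept, where [c] is at least [e]. The power [u^-b] is monotone
    in [b] in a direction that depends on whether [u < 1], hence the minimum over the two ends. *)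
Lemma kern_ge (u : R) : 0 < u -> e * (b2 - b1) * Num.min (u `^ (- b1)) (u `^ (- b2)) <= kern u.
Proof.
move=> u0; set w := Num.min _ _.
have w0 : 0 <= w by rewrite le_min !powR_ge0.
have mI : measurable (`[b1, b2]%classic : set R) by exact: measurable_itv.
have intI : integrable_fun (\1_(`[b1, b2]%classic : set R)) by exact: integrable_indic_itv.
have -> : e * (b2 - b1) * w = \int[mu]_b (\1_(`[b1, b2]%classic : set R) b * (e * w)).
  rewrite RintegralZr// mulrAC mulrC; congr (_ * _).
  rewrite /Rintegral integral_indic// setIT/= lebesgue_measure_itv/= lte_fin b12.
  by rewrite -EFinB.
apply: le_Rintegral => //; [|exact: integrable_ckpow|].
  rewrite /integrable_fun
    (_ : _ \o _ = (fun b => (\1_(`[b1, b2]%classic : set R) b)%:E * (e * w)%:E)%E)//.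
  exact: integrableZr.
move=> b _; rewrite indic_cc; case: (boolP (b1 <= b <= b2)) => [/andP[b1b bb2]|nb]; last first.
  by rewrite mul0r.
rewrite mul1r; apply: ler_pM => //; [exact: ltW|exact: ce|].
rewrite kpow_powR//; have [u1|u1] := leP 1 u.
  by rewrite /w ge_min; apply/orP; right; apply: ler_powR => //; rewrite lerN2.
by rewrite /w ge_min; apply/orP; left; apply: ger_powR; rewrite ?u0 ?(ltW u1) ?lerN2.
Qed.

Lemma kern_gt0 u : 0 < u -> 0 < kern u.
Proof.
move=> u0; apply: lt_le_trans (kern_ge u0).
by rewrite !mulr_gt0 ?subr_gt0// lt_min !powR_gt0.
Qed.

Lemma kern_ge_near0 (u : R) : 0 < u -> u <= 1 -> e * (b2 - b1) * u `^ (- b1) <= kern u.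
Proof.
move=> u0 u1; apply: le_trans (kern_ge u0); rewrite ler_wpM2l//.
  by rewrite mulr_ge0// ?subr_ge0; exact: ltW.
by rewrite le_min lexx/= ger_powR ?u0 ?u1// lerN2 ltW.
Qed.

(** The powers [u^-b] with [b < 1] are not integrable at infinity; on [[a, b]] only arguments up to
    [b - a] occur, so the kernel may be cut there. *)
Definition cut_kern (l u : R) : R := if u <= l then kern u else 0.

Lemma cut_kern_ge0 l u : 0 <= cut_kern l u.
Proof. by rewrite /cut_kern; case: ifP => // _; exact: kern_ge0. Qed.

Lemma cut_kern_nonincreasing l u v : 0 < u -> u <= v -> v <= l ->
  cut_kern l v <= cut_kern l u.
Proof.
by move=> u0 uv vl; rewrite /cut_kern vl (le_trans uv vl); exact: kern_nonincreasing.
Qed.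

Lemma cut_kern_supp l u : 0 < cut_kern l u -> 0 < u <= l.
Proof.
rewrite /cut_kern; case: (leP u l) => ul; last by rewrite ltxx.
by rewrite andbT; case: (ltP 0 u) => // /kern_le0 ->; rewrite ltxx.
Qed.

(** By Tonelli the integral in [u] comes first. It equals [l^(1 - b) / (1 - b)], and the hypothesis
    [c b <= C * (1 - b)] cancels the denominator. *)
Lemma integrable_cut_kern (l : R) : 0 < l -> integrable_fun (cut_kern l).
Proof.
move=> l0.
have mk : measurable_fun [set: R] (cut_kern l).
  apply: measurable_fun_ifT => //; first exact: measurable_fun_ler.
  exact: measurable_kern.
apply/integrableP; split; first exact/measurable_EFinP.
pose g u b := \1_(`]0, l]%classic : set R) u * (c b * kpow b u).
have mI : measurable (`]0, l]%classic : set R) by exact: measurable_itv.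
have mg : measurable_fun2 g.
  apply: measurable_fun2M mckpow.
  have mi : measurable_fun [set: R] (\1_(`]0, l]%classic : set R) : R -> R).
    exact: measurable_indic.
  exact: (measurable_fun2_comp mi measurable_fun2_fst).
have g0 u b : 0 <= g u b by rewrite mulr_ge0// indicE.
have -> : (\int[mu]_u `|(EFin \o cut_kern l) u| = \int[mu]_u \int[mu]_b (g u b)%:E)%E.
  apply: eq_integral => u _ /=; rewrite ger0_norm ?cut_kern_ge0// /g /cut_kern indic_oc.
  have [u0|u0] := ltP 0 u; last first.
    by under eq_integral do rewrite mul0r; rewrite integral0 (kern_le0 u0); case: ifP.
  case: leP => ul/=.
    by under eq_integral do rewrite mul1r; rewrite kernE.
  by under eq_integral do rewrite mul0r; rewrite integral0.
rewrite real_tonelli//.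
have H b : (\int[mu]_u (g u b)%:E <= (\1_(`[0, 1[%classic : set R) b * (C * (1 + l)))%:E)%E.
  rewrite /g indic_co; case: (boolP (0 <= b < 1)) => [/andP[bge blt]|nb]; last first.
    by under eq_integral do rewrite csupp// mul0r mulr0; rewrite integral0 mul0r.
  have ob0 : 0 < 1 - b by lra.
  have -> : (\int[mu]_u (\1_(`]0, l]%classic : set R) u * (c b * kpow b u))%:E =
      (c b)%:E * \int[mu]_(u in `]0%R, l]) (u `^ ((1 - b) - 1))%:E)%E.
    rewrite -ge0_integralZl//; last 3 first.
    - by apply: measurable_funTS; apply/measurable_EFinP; exact: measurable_powR.
    - by move=> u _; rewrite lee_fin powR_ge0.
    - by rewrite lee_fin.
    rewrite [RHS]integral_mkcond; apply: eq_integral => u _.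
    rewrite patchE mem_setE in_itv/= indic_oc; case: ifP => [/andP[u0 _]|_]; last by rewrite mul0r.
    by rewrite mul1r kpow_powR// EFinM; congr (_ * (_ `^ _)%:E)%E; lra.
  rewrite integral_powR// -EFinM lee_fin mul1r.
  have lb : l `^ (1 - b) <= 1 + l.
    have [l1|l1] := leP 1 l.
      rewrite (le_trans (ler1_powR l1 _))//; lra.
    rewrite (@le_trans _ _ 1)//; last by rewrite lerDl ltW.
    by rewrite -[leRHS](powRr0 l) ger_powR ?l0 ?(ltW l1)// ltW.
  rewrite mulrCA mulrC ler_pM// ?divr_ge0 ?(ltW ob0)//.
  - by rewrite powR_ge0.
  - by rewrite ler_pdivrMr// cC.
have /integrableP[_] := integrable_unit (C * (1 + l)).
apply: le_lt_trans; apply: ge0_le_integral => //.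
- by move=> b _; apply: integral_ge0 => u _; rewrite lee_fin.
- by apply: (@measurable_tonelli _ (fun b u => g u b)) => //; exact: measurable_fun2_swap.
- by apply: measurableT_comp => //; exact: (measurable_int _ (integrable_unit _)).
- by move=> b _; apply: (le_trans (H b)); rewrite lee_fin; exact: ler_norm.
Qed.

End kernel.

(** * Integrals of almost everywhere equal functions *)

Section ae_integral.
Context {R : realType}.
Local Notation mu := (@lebesgue_measure R).
Import HBNNSimple.

Let ge0_ae_le_integral (F G : R -> \bar R) : (forall x, 0 <= F x)%E ->
  (forall x, 0 <= G x)%E -> {ae mu, forall x, F x = G x} ->
  (\int[mu]_x F x <= \int[mu]_x G x)%E.
Proof.
move=> F0 G0 [N [mN N0 FN]]; rewrite ge0_integralTE//; apply: ge_ereal_sup.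
move=> _ [h hF <-]; have mNc := measurableC mN.
pose h' := proj_nnsfun h mNc.
have h'E x : h' x = (h \_ (~` N)) x by rewrite (mrestrict h mNc).
apply: (@le_trans _ _ (sintegral mu h')).
  rewrite -!integralT_nnsfun le_eqVlt; apply/orP; left; apply/eqP.
  apply: ae_eq_integral => //; [by apply/measurable_EFinP..|].
  exists N; split => // x; apply: contra_notP => xN _.
  by rewrite h'E patchE mem_set.
rewrite ge0_integralTE//; apply: ereal_sup_ubound; exists h' => // x.
rewrite h'E patchE; case: ifPn => [|_]; last exact: G0.
rewrite inE => xN; apply: (le_trans (hF x)).
by rewrite le_eqVlt; apply/orP; left; apply/eqP; apply: contrapT => FGx; apply: xN; exact: FN.
Qed.

(* Measurability is not assumed because [derive1 x] is only known almost everywhere.  The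
   integral of a nonnegative function is a supremum over simple functions below it, and
   these may be set to zero on a null set. *)
Lemma ae_eq_Rintegral (f g : R -> R) : {ae mu, forall x, f x = g x} ->
  \int[mu]_x f x = \int[mu]_x g x.
Proof.
move=> fg; rewrite /Rintegral; congr fine; rewrite integralE [RHS]integralE.
have E (F G : R -> \bar R) : (forall x, 0 <= F x)%E -> (forall x, 0 <= G x)%E ->
    {ae mu, forall x, F x = G x} -> (\int[mu]_x F x = \int[mu]_x G x)%E.
  move=> F0 G0 FG; apply/eqP; rewrite eq_le !ge0_ae_le_integral//.
  by apply: ae_imp FG => x ->.
by congr (_ - _)%E; apply: E => //; apply: ae_imp fg => x;
  rewrite ?funeposE ?funenegE => ->.
Qed.

End ae_integral.

(** * The weight [psi b / Gamma (1 - b)] of the order [b] *)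

Section order_weight_theory.
Context {R : realType}.
Local Notation mu := (@lebesgue_measure R).
Variable psi : R -> R.
Hypothesis hpsi : distr_weight psi.

(* The order [b = 1], where [Gamma (1 - b)] is a junk value, is dropped: it is a null set. *)
Definition order_weight (b : R) : R :=
  if 0 <= b < 1 then psi b * (Gamma (1 - b))^-1 else 0.

(** Writes [Gamma (1 - b)] as an integral over the whole line of a jointly measurable function, so
    that Tonelli yields measurability in [b]. *)
Lemma Gamma_kpow (b : R) : Gamma (1 - b) = fine (\int[mu]_t (kpow b t * expR (- t))%:E)%E.
Proof.
rewrite /Gamma /Rintegral integral_mkcond; congr fine; apply: eq_integral => t _.
rewrite patchE mem_setE in_itv/= andbT; case: ifPn => [t0|t0].
  by rewrite kpow_powR//; congr (_ `^ _ * _)%:E; lra.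
by rewrite /kpow (negbTE t0) mul0r.
Qed.

Lemma measurable_Gamma_onem : measurable_fun [set: R] (fun b : R => Gamma (1 - b)).
Proof.
rewrite (_ : (fun _ => _) = fun b => fine (\int[mu]_t (kpow b t * expR (- t))%:E)%E); last first.
  by apply/funext => b; exact: Gamma_kpow.
apply: (measurableT_comp (@fine_measurable R [set: \bar R] measurableT)).
apply: (@measurable_tonelli _ (fun b t => kpow b t * expR (- t))).
  apply: measurable_fun2M; first exact: measurable_kpow.
  apply: measurableT_comp => //; apply: measurableT_comp => //.
by move=> b t; rewrite mulr_ge0 ?kpow_ge0// expR_ge0.
Qed.

Lemma invGamma_bounds (b : R) : 0 <= b -> b < 1 ->
  (1 - b) / 2 <= (Gamma (1 - b))^-1 /\ (Gamma (1 - b))^-1 <= expR 1 * (1 - b).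
Proof.
move=> b0 b1; have z0 : 0 < 1 - b by lra.
have z1 : 1 - b <= 1 by lra.
have [lb ub] := Gamma_ge_le z0 z1.
have lb0 : 0 < expR (-1) / (1 - b) by rewrite divr_gt0 ?expR_gt0.
have G0 := lt_le_trans lb0 lb; split.
  rewrite -[leLHS]invrK lef_pV2 ?posrE//; last by rewrite invr_gt0 divr_gt0.
  apply: (le_trans ub); rewrite invf_div.
  have zi1 : 1 <= (1 - b)^-1 by rewrite invf_ge1.
  by rewrite (_ : 2 / (1 - b) = (1 - b)^-1 + (1 - b)^-1); [lra|field; lra].
rewrite -[leRHS]invrK lef_pV2 ?posrE//; last first.
  by rewrite invr_gt0 mulr_gt0 ?expR_gt0.
by rewrite invfM -expRN.
Qed.

Lemma measurable_order_weight : measurable_fun [set: R] order_weight.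
Proof.
have [cpsi _ _] := hpsi.
apply: measurable_fun_if => //.
- by apply: measurable_and; [exact: measurable_fun_ler|exact: measurable_fun_ltr].
- apply: measurable_funM.
    have mpsi : measurable_fun (`[0, 1]%classic : set R) psi.
      exact: subspace_continuous_measurable_fun.
    apply: measurable_funS mpsi => // b [_ /= /andP[b0 b1]].
    by rewrite in_itv/= b0 ltW.
  apply: measurable_funTS.
  (* The inverse becomes a composition of measurable functions. [Gamma] is nonnegative, so the other
     branch is the value [0], whose inverse is [0] by convention. *)
  have Ge b : (Gamma (1 - b))^-1 =
      if 0 < Gamma (1 - b) then expR (- ln (Gamma (1 - b))) else 0.
    case: ltP => [G0|G0]; first by rewrite expRN lnK.
    suff -> : Gamma (1 - b) = 0 by rewrite invr0.
    apply/eqP; rewrite eq_le G0/=; apply: Rintegral_ge0 => t _.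
    by rewrite mulr_ge0 ?powR_ge0 ?expR_ge0.
  under eq_fun do rewrite Ge.
  have mG := measurable_Gamma_onem.
  apply: measurable_fun_ifT => //; first exact: measurable_fun_ltr.
  by apply: measurableT_comp => //; apply: measurableT_comp => //; exact: measurableT_comp.
Qed.

Lemma order_weight_ge0 b : 0 <= order_weight b.
Proof.
rewrite /order_weight; case: ifP => // /andP[b0 b1].
have [_ p0 _] := hpsi; have [lb _] := invGamma_bounds b0 b1.
by rewrite mulr_ge0 ?p0 ?in_itv/= ?b0 ?(ltW b1)// (le_trans _ lb)// divr_ge0// subr_ge0 ltW.
Qed.

Lemma order_weight_supp (b : R) : ~~ (0 <= b < 1) -> order_weight b = 0.
Proof. by rewrite /order_weight => /negbTE ->. Qed.

Lemma order_weight_le : exists C : R, forall b : R, 0 <= b -> b < 1 ->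
  order_weight b <= C * (1 - b).
Proof.
have [cpsi p0 _] := hpsi.
have [x x01 xmax] := EVT_max ler01 cpsi.
exists (psi x * expR 1) => b b0 b1; rewrite /order_weight b0 b1/=.
have [lb ub] := invGamma_bounds b0 b1.
have b01 : b \in `[0, 1] by rewrite in_itv/= b0 ltW.
rewrite -mulrA ler_pM ?p0 ?xmax//.
by rewrite (le_trans _ lb)// divr_ge0// subr_ge0 ltW.
Qed.

(** The endpoints are null, so [psi] is positive at some interior order. Staying away from [0] makes
    the kernel blow up at [0]; staying away from [1] keeps [1 / Gamma (1 - b)] bounded below. *)
Lemma order_weight_ge : exists b1 b2 e : R, [/\ 0 < b1, b1 < b2, 0 < e &
  forall b, b1 <= b -> b <= b2 -> e <= order_weight b].
Proof.
have [cpsi p0 ppos] := hpsi.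
have [b0 [b00 b01 pb0]] : exists b0 : R, [/\ 0 < b0, b0 < 1 & 0 < psi b0].
  apply: contrapT => H; move: ppos.
  have ip : mu.-integrable `[0, 1] (EFin \o psi).
    by apply: continuous_compact_integrable => //; exact: segment_compact.
  rewrite -Rintegral_itv_obnd_cbnd; last by apply: integrableS ip => //; exact: subset_itv_oc_cc.
  rewrite -Rintegral_itv_bndo_bndc; last by apply: integrableS ip => //; exact: subset_itv_oo_cc.
  have -> : \int[mu]_(b in `]0, 1[) psi b = \int[mu]_(b in `]0, 1[) 0.
    apply: eq_Rintegral => b.
    rewrite inE/= in_itv/= => /andP[b_0 b_1]; apply/eqP.
    rewrite eq_le p0 ?in_itv/= ?(ltW b_0) ?(ltW b_1)//.
    by rewrite andbT leNgt; apply/negP => pb; apply: H; exists b.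
  by rewrite Rintegral_cst// mul0r ltxx.
have pc : {for b0, continuous psi}.
  by apply: (within_continuous_continuous ltr01 cpsi); rewrite in_itv/= b00.
have [d /= d0 dP] : exists2 d : R, 0 < d & forall b, `|b0 - b| < d -> psi b0 / 2 < psi b.
  have p20 : 0 < psi b0 / 2 by lra.
  move: pc => /cvgrPdist_lt/(_ _ p20)[d d0 H].
  exists d => // b /H /=; rewrite ltr_norml; lra.
(* Within [d / 2] of [b0] the function [psi] stays above [psi b0 / 2]; the other two bounds keep
   [b0 - w] above [0] and [b0 + w] below [1]. *)
pose w := Num.min (d / 2) (Num.min (b0 / 2) ((1 - b0) / 2)).
have w0 : 0 < w by rewrite !lt_min; apply/and3P; split; lra.
have [wd wb w1] : [/\ w <= d / 2, w <= b0 / 2 & w <= (1 - b0) / 2].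
  by rewrite /w; split; rewrite !ge_min lexx ?orbT.
exists (b0 - w), (b0 + w), (psi b0 / 2 * ((1 - (b0 + w)) / 2)); split; [lra|lra| |].
  by apply: mulr_gt0; lra.
move=> b bl br; rewrite /order_weight.
have b0' : 0 <= b by lra.
have b1' : b < 1 by lra.
rewrite b0' b1'/=; have [lb _] := invGamma_bounds b0' b1'.
apply: ler_pM; [lra|lra| |].
  by apply/ltW/dP; rewrite ltr_norml; lra.
by apply: le_trans lb; lra.
Qed.

End order_weight_theory.

(** * The distributed-order derivative as a convolution *)

Section caputo_convolution.
Context {R : realType}.
Local Notation mu := (@lebesgue_measure R).

Lemma measurable_fun2_comp2 (g p q : R -> R -> R) : measurable_fun2 g ->
  measurable_fun2 p -> measurable_fun2 q ->
  measurable_fun2 (fun x y => g (p x y) (q x y)).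
Proof.
by move=> mg mp mq; exact: (measurableT_comp mg (measurable_fun_pair mp mq)).
Qed.

Variables (psi : R -> R) (a b : R).
Hypotheses (hpsi : distr_weight psi) (ab : a < b).

Definition order_kernel : R -> R := kern (order_weight psi).

Definition window_kernel : R -> R := cut_kern (order_weight psi) (b - a).

Lemma integrable_window_kernel : integrable_fun window_kernel.
Proof.
have [C hC] := order_weight_le hpsi.
apply: (integrable_cut_kern (C := C)) => //.
- exact: measurable_order_weight.
- exact: order_weight_ge0.
- by move=> ?; exact: order_weight_supp.
- by rewrite subr_gt0.
Qed.

Lemma window_kernel_ge0 u : 0 <= window_kernel u.
Proof. by apply: cut_kern_ge0 => ?; exact: order_weight_ge0. Qed.

Lemma integrable_order_weight_kpow u :
  integrable_fun (fun be => order_weight psi be * kpow be u).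
Proof.
have [C hC] := order_weight_le hpsi.
apply: (integrable_ckpow (C := C)) => //.
- exact: measurable_order_weight.
- exact: order_weight_ge0.
- by move=> ?; exact: order_weight_supp.
Qed.

Lemma order_kernelE u :
  (\int[mu]_be (order_weight psi be * kpow be u)%:E = (order_kernel u)%:E)%E.
Proof.
by rewrite /order_kernel /kern fineK//; exact: integrable_fin_num (integrable_order_weight_kpow u).
Qed.

Lemma order_kernel_ge0 u : 0 <= order_kernel u.
Proof. by apply: kern_ge0 => ?; exact: order_weight_ge0. Qed.

Variables (x f : R -> R).
Hypotheses (intf : integrable_fun f)
  (xE : forall t, a <= t <= b -> x t = x a + \int[mu]_(r in `[a, t]) f r).

(** The indicator supplies the lower limit [a] of the fractional integral and causality of the
    kernel the upper limit, so the convolution can run over the whole line. *)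
Definition density_in : R -> R := fun r => \1_(`[a, b]%classic : set R) r * f r.

Lemma integrable_density_in : integrable_fun density_in.
Proof. by apply: integrable_fun_indic. Qed.

(** Order [1] is excluded because the Riemann-Liouville integral is then the identity and not a
    convolution. *)
Lemma caputo_kpow (be s : R) : be != 1 -> a < s < b ->
  Caputo_left a be x s =
  (Gamma (1 - be))^-1 * \int[mu]_r (kpow be (s - r) * density_in r).
Proof.
move=> be1 /andP[as_ sb]; rewrite /Caputo_left /RL_left subr_eq0 eq_sym (negbTE be1).
congr (_ * _); rewrite Rintegral_mkcond; apply: ae_eq_Rintegral.
(* Two points are discarded: at [r = a] the derivative is not controlled, and at [r = s] the two
   powers may follow different conventions at zero. *)
have := ae_and (derive1_density intf xE) (ae_and (ae_neq a) (ae_neq s)).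
apply: ae_imp => r [dx [ra rs]]; rewrite patchE mem_setE in_itv/=.
rewrite /density_in indicE mem_setE in_itv/=.
have [ar|ar]/= := leP a r; last by rewrite mul0r mulr0.
have [rs'|rs']/= := leP r s; last by rewrite /kpow subr_gt0 ltNge (ltW rs')/= mul0r.
have sr : r < s by rewrite lt_neqAle rs.
rewrite dx; last by rewrite lt_neqAle eq_sym ra ar (lt_trans sr).
rewrite kpow_powR ?subr_gt0// (ltW (lt_trans sr sb)) mul1r.
by congr (_ `^ _ * _); lra.
Qed.

(** Fubini in the order and in [r], at each interior [s] where the convolution integrand is
    integrable, hence at almost every one. *)
Lemma distr_caputo_conv : {ae mu, forall s, a < s < b ->
  \int[mu]_(be in `[0, 1]) (psi be * Caputo_left a be x s) =
  conv window_kernel density_in s}.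
Proof.
have intd := integrable_density_in.
have := conv_ae_integrable integrable_window_kernel window_kernel_ge0 intd.
apply: ae_imp => s ints sab; have /andP[as_ sb] := sab.
pose c := order_weight psi.
have mc : measurable_fun [set: R] c by exact: measurable_order_weight.
pose g r be := c be * kpow be (s - r) * density_in r.
have md := integrable_fun_measurable intd.
have mg : measurable_fun2 g.
  apply: measurable_fun2M; last exact: (measurable_fun2_comp md measurable_fun2_fst).
  apply: measurable_fun2M; first exact: (measurable_fun2_comp mc measurable_fun2_snd).
  apply: (measurable_fun2_comp2 measurable_kpow measurable_fun2_snd).
  by apply: measurable_fun2B; [exact: measurable_cst|exact: measurable_fun2_fst].
(* For [r] in [[a, b]] and [s < b] the argument [s - r] stays below [b - a], so the cut is not
   felt. *)
have winE r : density_in r != 0 -> window_kernel (s - r) = order_kernel (s - r).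
  rewrite /density_in indicE mem_setE in_itv/=.
  case: (boolP (a <= r <= b)) => [/andP[ar rb] _|_]; last by rewrite mul0r eqxx.
  by rewrite /window_kernel /cut_kern ifT//; lra.
have glty : (\int[mu]_r \int[mu]_be `|g r be|%:E < +oo)%E.
  have /integrableP[_] := ints; apply: le_lt_trans.
  rewrite le_eqVlt; apply/orP; left; apply/eqP; apply: eq_integral => r _ /=.
  have [d0|d0] := eqVneq (density_in r) 0.
    rewrite /g d0 mulr0 normr0; under eq_integral do rewrite mulr0 normr0.
    by rewrite integral0.
  rewrite winE// normrM ger0_norm ?order_kernel_ge0// EFinM -order_kernelE.
  rewrite -ge0_integralZr//.
  - apply: eq_integral => be _; rewrite /g normrM -EFinM; congr (_ * _)%:E.
    by rewrite ger0_norm// mulr_ge0 ?kpow_ge0// order_weight_ge0.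
  - exact: measurable_int (integrable_order_weight_kpow _).
  - by move=> be _; rewrite lee_fin mulr_ge0 ?kpow_ge0// order_weight_ge0.
have [_ aeb _ _ eg] := real_fubini mg glty.
have -> : conv window_kernel density_in s = \int[mu]_r \int[mu]_be g r be.
  apply: eq_Rintegral => r _; rewrite /g RintegralZr//; last exact: integrable_order_weight_kpow.
  have [->|d0] := eqVneq (density_in r) 0; first by rewrite !mulr0.
  by rewrite winE.
rewrite eg Rintegral_mkcond; apply: ae_eq_Rintegral.
have := ae_and aeb (ae_neq 1); apply: ae_imp => be [intb be1].
rewrite patchE mem_setE in_itv/=; case: ifPn => [/andP[be0 bel1]|nbe]; last first.
  have cb0 : c be = 0.
    by apply: order_weight_supp; apply: contra nbe => /andP[-> /ltW].
  by rewrite /g; under eq_Rintegral do rewrite cb0 !mul0r; rewrite Rintegral_cst// mul0r.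
have blt : be < 1 by rewrite lt_neqAle be1.
rewrite caputo_kpow// mulrA.
have cE : c be = psi be * (Gamma (1 - be))^-1 by rewrite /c /order_weight be0 blt.
(* Fubini gives integrability only of the product with [c be]; recovering the integrand means
   dividing by this factor. *)
rewrite -cE; have [c0|c0] := eqVneq (c be) 0.
  rewrite c0 mul0r /g; under [RHS]eq_Rintegral do rewrite c0 !mul0r.
  by rewrite Rintegral_cst// mul0r.
rewrite /g; under [RHS]eq_Rintegral do rewrite -mulrA.
rewrite RintegralZl//.
have -> : EFin \o (fun r => kpow be (s - r) * density_in r) =
    (fun r => ((c be)^-1)%:E * (g r be)%:E)%E.
  by apply/funext => r /=; rewrite -EFinM /g -mulrA mulKf.
by apply: integrableZl => //; exact: intb.
Qed.

End caputo_convolution.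

(** * The maximum principle for monotone kernels *)

Section maximum_principle.
Context {R : realType}.
Local Notation mu := (@lebesgue_measure R).
Variables (kap f : R -> R) (a b : R).
Hypotheses (ab : a < b) (intk : integrable_fun kap) (k0 : forall x, 0 <= kap x)
  (kmon : forall x y : R, 0 < x -> x <= y -> y <= b - a -> kap y <= kap x)
  (ksupp : forall x : R, 0 < kap x -> 0 < x <= b - a)
  (intf : integrable_fun f) (fsupp : forall r : R, r < a -> f r = 0).

(** Integrating from [-oo] defines the function left of [a] as well, where it vanishes, so that
    windows [[t - h, t]] may stick out of [[a, b]]. *)
Definition primitive (x : R) := \int[mu]_(r in `]-oo, x]) f r.

Local Notation W := primitive.

Let intfS (D : set R) : measurable D -> mu.-integrable D (EFin \o f).
Proof. by move=> mD; exact: integrableS intf. Qed.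

Lemma primitive_lt (x : R) : x < a -> W x = 0.
Proof.
move=> xa; rewrite /W (_ : \int[mu]_(r in `]-oo, x]) f r = \int[mu]_(r in `]-oo, x]) 0).
  by rewrite Rintegral_cst// mul0r.
apply: eq_Rintegral => r; rewrite inE/= in_itv/= => rx.
by apply: fsupp; exact: le_lt_trans xa.
Qed.

Lemma primitiveB (x y : R) : x <= y -> W y - W x = \int[mu]_(r in `]x, y]) f r.
Proof.
by move=> xy; rewrite /W Rintegral_itvB//; exact: intfS.
Qed.

Let B := fine (\int[mu]_r `|f r|%:E)%E.

Let int_abs_fin : (\int[mu]_r `|f r|%:E)%E \is a fin_num.
Proof.
rewrite ge0_fin_numE; first by move/integrableP: intf => [].
by apply: integral_ge0 => x _; rewrite lee_fin.
Qed.

Lemma primitive_bounded (x : R) : `|W x| <= B.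
Proof.
rewrite -lee_fin /B fineK// /W EFin_normr_Rintegral//; last exact: intfS.
apply: le_trans (le_abse_integral _ _ _) _ => //.
  by have /integrableP[] := intfS (measurable_itv `]-oo, x]).
apply: ge0_subset_integral => //=.
apply/measurable_EFinP; apply: (measurableT_comp (@normr_measurable R [set: R])).
exact: integrable_fun_measurable.
Qed.

Lemma primitive_uniform_continuous (e : R) : 0 < e -> exists2 d : R, 0 < d &
  forall x y : R, x <= y -> y - x < d -> `|W y - W x| <= e.
Proof.
move=> e0.
have [d [d0 H]] := integral_normr_continuous intf e0.
exists d => // x y xy yxd; rewrite primitiveB//.
apply: le_trans (le_normr_Rintegral _ _) _ => //; first exact: intfS.
apply/ltW/H => //; rewrite /= lebesgue_measure_itv/= lte_fin.
by case: ifP => _; rewrite -?EFinB lte_fin.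
Qed.

Lemma primitive_continuous : continuous W.
Proof.
move=> x; apply/cvgrPdist_le => e e0.
have [d d0 H] := primitive_uniform_continuous e0.
near=> y; have : `|x - y| < d by near: y; exact: cvgr_dist_lt.
case: (leP x y) => [xy|/ltW xy]; rewrite ltr_norml => /andP[h1 h2].
  by rewrite distrC H//; lra.
by rewrite H//; lra.
Unshelve. all: by end_near. Qed.

Let measurable_primitive : measurable_fun [set: R] W.
Proof. by apply: continuous_measurable_fun; exact: primitive_continuous. Qed.

Let intW (s t : R) : mu.-integrable `[s, t] (EFin \o W).
Proof.
apply: continuous_compact_integrable; first exact: segment_compact.
by apply: continuous_subspaceT => x; exact: primitive_continuous.
Qed.

Section window.
Variable h : R.
Hypothesis h0 : 0 < h.

(** [V] is [h] times the window average of [W], and [v] below is its derivative. Unlike [f], the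
    function [v] is bounded, as the monotone-kernel bound requires. *)
Let V (t : R) := \int[mu]_(r in `[t - h, t]) W r.
Let v (r : R) := W r - W (r - h).

Let mshift : measurable_fun [set: R] (fun r => W (r - h)).
Proof. by apply: measurableT_comp => //; exact: measurable_funB. Qed.

Let mv : measurable_fun [set: R] v.
Proof. exact: measurable_funB. Qed.

Let vB (r : R) : `|v r| <= B + B.
Proof. by rewrite (le_trans (ler_normB _ _))// lerD// primitive_bounded. Qed.

Let tailE (s t : R) : s <= t -> \int[mu]_(r in `[s, t]) v r = V t - V s.
Proof.
move=> st; have hh := h0.
have intWh : mu.-integrable `[s, t] (EFin \o (fun r => W (r - h))).
  apply: continuous_compact_integrable; first exact: segment_compact.
  apply: continuous_subspaceT => x.
  apply: (@continuous_comp _ _ _ (fun r : R => r - h) W); last exact: primitive_continuous.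
  by apply: (@continuousB _ _ _ id (cst h)) => //; exact: cst_continuous.
have -> : \int[mu]_(r in `[s, t]) v r =
    \int[mu]_(r in `[s, t]) W r - \int[mu]_(r in `[s, t]) W (r - h).
  exact: (@RintegralB _ _ R mu `[s, t]%classic W (fun r : R => W (r - h))
    (measurable_itv _) (intW s t) intWh).
have -> : \int[mu]_(r in `[s, t]) W (r - h) = \int[mu]_(r in `[s - h, t - h]) W r.
  rewrite Rintegral_indic [RHS]Rintegral_indic.
  rewrite -[RHS](Rintegral_preserving (measure_preserving_shift (- h)))/=; last first.
    by apply: measurable_funM => //; exact: measurable_indic.
  apply: eq_Rintegral => r _; congr (_ * _); rewrite !indicE !mem_setE !in_itv/=.
  by rewrite !lerD2r.
have cut (c : R) : s - h <= c -> c <= t ->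
    \int[mu]_(r in `[s - h, t]) W r - \int[mu]_(r in `[s - h, c]) W r = \int[mu]_(r in `[c, t]) W r.
  move=> sc ct; rewrite Rintegral_itvB// ?bnd_simp//.
  rewrite Rintegral_itv_obnd_cbnd//; apply: integrableS (intW c t) => //.
  exact: subset_itv_oc_cc.
have c1 := cut s ltac:(lra) st.
have c2 := cut (t - h) ltac:(lra) ltac:(lra).
rewrite /V; lra.
Qed.

Let V_le (t S : R) : (forall r : R, t - h <= r -> r <= t -> W r <= S) -> V t <= h * S.
Proof.
move=> HS; have hh := h0; have -> : h * S = \int[mu]_(r in `[t - h, t]) S.
  rewrite Rintegral_cst// /= lebesgue_measure_itv/= lte_fin ifT; last by lra.
  by rewrite -EFinB/= mulrC; congr (_ * _); lra.
apply: le_Rintegral => //.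
  apply: continuous_compact_integrable; first exact: segment_compact.
  by apply: continuous_subspaceT => x; exact: cst_continuous.
by move=> r /=; rewrite in_itv/= => /andP[? ?]; exact: HS.
Qed.

Let V_ge (t S : R) : (forall r : R, t - h <= r -> r <= t -> S <= W r) -> h * S <= V t.
Proof.
move=> HS; have hh := h0; have -> : h * S = \int[mu]_(r in `[t - h, t]) S.
  rewrite Rintegral_cst// /= lebesgue_measure_itv/= lte_fin ifT; last by lra.
  by rewrite -EFinB/= mulrC; congr (_ * _); lra.
apply: le_Rintegral => //.
  apply: continuous_compact_integrable; first exact: segment_compact.
  by apply: continuous_subspaceT => x; exact: cst_continuous.
by move=> r /=; rewrite in_itv/= => /andP[? ?]; exact: HS.
Qed.

Let V_lipschitz (s t : R) : s <= t -> `|V t - V s| <= (B + B) * (t - s).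
Proof.
move=> st; rewrite -tailE//.
have iv : mu.-integrable `[s, t] (EFin \o v).
  apply: measurable_bounded_integrable => //.
  - by rewrite /= lebesgue_measure_itv/= lte_fin; case: ifP => _; rewrite -?EFinB ltry.
  - exact: measurable_funTS.
  - exists (B + B); split; first exact: num_real.
    by move=> y Hy r _; rewrite /= (le_trans (vB r))// ltW.
apply: le_trans (le_normr_Rintegral _ iv) _ => //.
have -> : (B + B) * (t - s) = \int[mu]_(r in `[s, t]) (B + B).
  rewrite Rintegral_cst// /= lebesgue_measure_itv/= lte_fin; case: ltP => [_|ts].
    by rewrite -EFinB/=.
  by rewrite (_ : t = s) ?subrr/= ?mulr0//; apply/le_anti/andP.
apply: le_Rintegral => //.
- by move/integrable_norm : iv.
- apply: continuous_compact_integrable; first exact: segment_compact.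
  by apply: continuous_subspaceT => x; exact: cst_continuous.
Qed.

Let V_continuous : continuous V.
Proof.
move=> x; apply/cvgrPdist_le => e e0.
have B0 : 0 <= B by apply: le_trans (primitive_bounded 0).
near=> y; have : `|x - y| < e / (B + B + 1).
  by near: y; apply: cvgr_dist_lt => //; rewrite divr_gt0//; lra.
rewrite ltr_pdivlMr; last by lra.
case: (leP x y) => [xy|/ltW xy].
  rewrite distrC [in X in _ -> X]distrC => H; have := V_lipschitz xy.
  rewrite ger0_norm in H; last by lra.
  by move=> /le_trans; apply; nra.
move=> H; have := V_lipschitz xy.
rewrite ger0_norm in H; last by lra.
by move=> /le_trans; apply; nra.
Unshelve. all: by end_near. Qed.

(* At a maximum point [t0] of the window average [V], all the integrals of [v] over
   [[s, t0]] are nonnegative, so [monotone_kernel_ge] bounds [k * v] at [t0], which is the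
   window integral of [conv kap f], from below. *)
Lemma conv_bound_window (p q S e C : R) :
  (forall x y : R, x <= y -> y - x <= h -> `|W y - W x| <= e) ->
  a <= p -> p < q -> q <= b -> 0 <= S -> 0 <= C -> 0 < kap (q - p) ->
  (forall t, t <= p -> W t <= S) ->
  {ae mu, forall s : R, p < s < q -> conv kap f s <= C} ->
  forall t, t <= q -> W t <= S + e + e + C / kap (q - p).
Proof.
move=> We ap pq qb S0 C0 kpq WS convC t tq; have hh := h0.
have e0 : 0 <= e by apply: le_trans (We t t _ _) => //; lra.
(* At [a - 1] and everywhere to its left [V] is zero, so a maximum over [[a - 1, q]] is one over all
   [s <= q]. *)
have [t0 t0q Vmax] : exists2 t0 : R, t0 <= q & forall s : R, s <= q -> V s <= V t0.
  have [||t0] := @EVT_max R V (a - 1) q; first lra.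
    by apply: continuous_subspaceT => x; exact: V_continuous.
  rewrite in_itv/= => /andP[_ t0q] Vm; exists t0 => // s sq.
  have [as1|sa1] := leP (a - 1) s; first by apply: Vm; rewrite in_itv/= as1.
  apply: le_trans (Vm (a - 1) _); last by rewrite in_itv/= lexx/=; lra.
  have Vs : V s <= h * 0 by apply: V_le => r _ rs; rewrite primitive_lt//; lra.
  by apply: le_trans Vs _; apply: V_ge => r _ rs; rewrite primitive_lt//; lra.
(* A window ending by [p + h] exceeds [p] by at most [h], which costs the first [e]. *)
have Vp (s : R) : s <= p + h -> V s <= h * (S + e).
  move=> sp; apply: V_le => r _ rs; have [rp|pr] := leP r p.
    by have := WS _ rp; lra.
  have := We p r (ltW pr) ltac:(lra); rewrite ler_norml => /andP[_].
  by have := WS p (lexx p); lra.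
have kh : V t0 - h * (S + e) <= h * (C / kap (q - p)).
  have [t0p|pt0] := leP t0 (p + h).
    by have := Vp _ t0p; have : 0 <= h * (C / kap (q - p)); [rewrite mulr_ge0 ?divr_ge0// ltW|lra].
  rewrite mulrA ler_pdivlMr//.
  have [m0|m0] := leP (V t0 - h * (S + e)) 0.
    by apply: (@le_trans _ _ 0); [nra|rewrite mulr_ge0// ltW].
  have tail0 (s : R) : s <= t0 -> 0 <= \int[mu]_(r in `[s, t0]) v r.
    by move=> st; rewrite tailE// subr_ge0 Vmax//; lra.
  (* The tails are large from [p + h] rather than from [p]. The kernel is thus evaluated at
     [t0 - (p + h)], which is at most [q - p], and monotonicity restores [kap (q - p)]. *)
  have tailm (s : R) : s <= p + h -> V t0 - h * (S + e) <= \int[mu]_(r in `[s, t0]) v r.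
    by move=> sp; rewrite tailE; [have := Vp _ sp|]; lra.
  have := monotone_kernel_ge intk k0 kmon ksupp mv vB tail0 tailm.
  have -> : \int[mu]_r (kap (t0 - r) * v r) = \int[mu]_(s in `[t0 - h, t0]) conv kap f s.
    rewrite Rintegral_conv_window// ?ltW//; apply: eq_Rintegral => r _; congr (_ * _).
    rewrite /v primitiveB; last by lra.
    by rewrite Rintegral_itv_obnd_cbnd//; exact: intfS.
  have : \int[mu]_(s in `[t0 - h, t0]) conv kap f s <= h * C.
    have mem_itv (s : R) : s \in `[t0 - h, t0]%classic -> t0 - h <= s <= t0.
      by rewrite mem_setE in_itv.
    have -> : h * C = \int[mu]_(s in `[t0 - h, t0]) C.
      rewrite Rintegral_cst// /= lebesgue_measure_itv/= lte_fin ifT; last by lra.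
      by rewrite -EFinB/= mulrC; congr (_ * _); lra.
    have iC : mu.-integrable `[t0 - h, t0] (EFin \o cst C).
      apply: continuous_compact_integrable; first exact: segment_compact.
      by apply: continuous_subspaceT => x; exact: cst_continuous.
    have ic : mu.-integrable `[t0 - h, t0] (EFin \o conv kap f).
      by apply: integrableS (integrable_conv intk k0 intf).
    rewrite -subr_ge0 -(@RintegralB _ _ R mu `[t0 - h, t0]%classic (cst C) (conv kap f)
      (measurable_itv _) iC ic).
    rewrite Rintegral_mkcond.
    (* The bound by [C] holds only almost everywhere; taking the maximum with [0] gives an integrand
       that is nonnegative everywhere and has the same integral. *)
    rewrite (@ae_eq_Rintegral R _ (fun s =>
      Num.max 0 ((fun s => cst C s - conv kap f s) \_ `[t0 - h, t0]%classic s))).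
      by apply: Rintegral_ge0 => s _; rewrite le_max lexx.
    have := ae_and convC (ae_neq q); apply: ae_imp => s [cs sq].
    rewrite max_r// patchE; case: ifPn => // /mem_itv/andP[ts st]; rewrite subr_ge0 cs//.
    by rewrite (lt_le_trans _ ts) ?lt_neqAle ?sq ?(le_trans st)//; lra.
  have : kap (q - p) <= kap (t0 - (p + h)) by apply: kmon; lra.
  nra.
(* Returning from the window average to the value at [t] costs the second [e]. *)
have : h * (W t - e) <= V t.
  apply: V_ge => r tr rt; have := We r t rt ltac:(lra).
  by rewrite ler_norml => /andP[_]; lra.
have := Vmax _ tq.
move: kh; set Z := C / _ => kh h1 h2.
by rewrite -(ler_pM2l hh); lra.
Qed.

End window.

Lemma conv_bound (p q S C : R) :
  a <= p -> p < q -> q <= b -> 0 <= S -> 0 <= C -> 0 < kap (q - p) ->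
  (forall t, t <= p -> W t <= S) ->
  {ae mu, forall s : R, p < s < q -> conv kap f s <= C} ->
  forall t, t <= q -> W t <= S + C / kap (q - p).
Proof.
move=> ap pq qb S0 C0 kpq WS convC t tq; apply/ler_addgt0Pr => e e0.
have e2 : 0 < e / 2 by rewrite divr_gt0.
have [d d0 Wd] := primitive_uniform_continuous e2.
have hd : 0 < d / 2 by rewrite divr_gt0.
have We (x y : R) : x <= y -> y - x <= d / 2 -> `|W y - W x| <= e / 2.
  by move=> xy xyd; apply: Wd => //; lra.
have := conv_bound_window hd We ap pq qb S0 C0 kpq WS convC tq; lra.
Qed.

End maximum_principle.

(** * Comparison of functions through their distributed-order derivatives *)

Section distributed_comparison.
Context {R : realType}.
Local Notation mu := (@lebesgue_measure R).
Variables (psi : R -> R) (hpsi : distr_weight psi).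

Let k := order_kernel psi.

Definition distr_caputo (a : R) (x : R -> R) (t : R) : R :=
  \int[mu]_(be in `[0, 1]) (psi be * Caputo_left a be x t).

Lemma distr_caputo_cst (a c t : R) : distr_caputo a (cst c) t = 0.
Proof.
rewrite /distr_caputo (_ : \int[mu]_(be in `[0, 1]) _ = \int[mu]_(be in `[0, 1]) 0).
  by rewrite Rintegral_cst// mul0r.
apply: eq_Rintegral => be _; rewrite /Caputo_left /RL_left.
have d0 (s : R) : derive1 (cst c) s = 0 by rewrite derive1_cst.
case: ifP => _; first by rewrite d0 mulr0.
under [in X in _ * (_ * X)]eq_Rintegral do rewrite d0 mulr0.
by rewrite Rintegral_cst// mul0r !mulr0.
Qed.

Lemma order_kernel_gt0 (u : R) : 0 < u -> 0 < k u.
Proof.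
have [C HC] := order_weight_le hpsi; have [b1 [b2 [e [_ b12 e0 He]]]] := order_weight_ge hpsi.
exact: (kern_gt0 (measurable_order_weight hpsi) (order_weight_ge0 hpsi) HC
  (@order_weight_supp _ psi) b12 e0 He).
Qed.

Lemma order_kernel_nonincreasing (u v : R) : 0 < u -> u <= v -> k v <= k u.
Proof.
have [C HC] := order_weight_le hpsi.
exact: (kern_nonincreasing (measurable_order_weight hpsi) (order_weight_ge0 hpsi) HC
  (@order_weight_supp _ psi)).
Qed.

Lemma order_kernel_near0 (M : R) : exists2 d : R, 0 < d & forall u : R, 0 < u -> u <= d -> M <= k u.
Proof.
have [C HC] := order_weight_le hpsi; have [b1 [b2 [e [b10 b12 e0 He]]]] := order_weight_ge hpsi.
pose m : R := `|M| + 1; have m0 : 0 < m by rewrite /m; have := normr_ge0 M; lra.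
(* Chosen so that [u]^ b1 <= c[says exactly that the lower bound]e * (b2 - b1) * u [^ (- b1)] of the
   kernel is at least [m]. The [1] in the minimum below is where that lower bound is valid. *)
pose c := e * (b2 - b1) / m; have c0 : 0 < c by rewrite divr_gt0// mulr_gt0// subr_gt0.
have d0 : 0 < Num.min 1 (c `^ b1^-1) by rewrite lt_min ltr01/= powR_gt0.
exists (Num.min 1 (c `^ b1^-1)) => // u u0; rewrite le_min => /andP[u1 uc].
have := kern_ge_near0 (measurable_order_weight hpsi) (order_weight_ge0 hpsi) HC
  (@order_weight_supp _ psi) b12 e0 He u0 u1.
rewrite -/(order_kernel psi u) -/(k u); apply: le_trans.
apply: (@le_trans _ _ m); first by rewrite /m; have := ler_norm M; lra.
have : u `^ b1 <= c.
  have -> : c = (c `^ b1^-1) `^ b1 by rewrite -powRrM mulVf ?powRr1 ?gt_eqF// ltW.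
  by apply: ge0_ler_powR => //; rewrite ?nnegrE ?powR_ge0// ltW.
rewrite /c ler_pdivlMr// mulrC => h.
by rewrite powRN ler_pdivlMr// powR_gt0.
Qed.

Section scalar.
Variables (a b : R) (ab : a < b) (x1 x2 g1 g2 : R -> R).
Hypotheses (ac1 : abs_cont_seq a b x1) (ac2 : abs_cont_seq a b x2) (x12 : x1 a = x2 a)
  (D1 : {ae mu, forall s, a < s < b -> distr_caputo a x1 s = g1 s})
  (D2 : {ae mu, forall s, a < s < b -> distr_caputo a x2 s = g2 s}).

(** The functions agree at [a], so [x1 - x2] is the primitive of the difference of their densities.
    The maximum principle bounds it from above; exchanging the two functions gives the other
    side. *)
Lemma distr_caputo_sub_le (p q S C : R) : a <= p -> p < q -> q <= b -> 0 <= S -> 0 <= C ->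
  (forall t, a <= t <= p -> x1 t - x2 t <= S) ->
  {ae mu, forall s : R, p < s < q -> g1 s - g2 s <= C} ->
  forall t, a <= t <= q -> x1 t - x2 t <= S + C / k (q - p).
Proof.
move=> ap pq qb S0 C0 xS gC t /andP[at_ tq].
have [f1 if1 E1] := abs_cont_density ab ac1; have [f2 if2 E2] := abs_cont_density ab ac2.
pose kap := window_kernel psi a b.
pose F1 := density_in a b f1; pose F2 := density_in a b f2.
pose f r := F1 r - F2 r.
have iF1 : integrable_fun F1 by exact: integrable_density_in.
have iF2 : integrable_fun F2 by exact: integrable_density_in.
have intf : integrable_fun f by exact: (@integrableB _ _ R mu setT measurableT _ _ iF1 iF2).
have intk : integrable_fun kap := integrable_window_kernel hpsi ab.
have k0 : forall u, 0 <= kap u := window_kernel_ge0 a b hpsi.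
have fsupp (r : R) : r < a -> f r = 0.
  move=> ra; rewrite /f /F1 /F2 /density_in indicE mem_setE in_itv/= leNgt ra/=.
  by rewrite !mul0r subrr.
have Wx (s : R) : a <= s <= b -> primitive f s = x1 s - x2 s.
  move=> /andP[as_ sb]; have sab : a <= s <= b by rewrite as_.
  rewrite (E1 _ sab) (E2 _ sab) x12 /primitive [LHS]Rintegral_indic.
  have -> : \int[mu]_r (\1_`]-oo, s] r * f r) =
      \int[mu]_r (\1_`[a, s] r * f1 r - \1_`[a, s] r * f2 r).
    apply: eq_Rintegral => r _; rewrite /f /F1 /F2 /density_in mulrBr !mulrA.
    have -> : \1_`]-oo, s] r * \1_`[a, b] r = \1_`[a, s] r :> R.
      rewrite !indicE !mem_setE !in_itv/= -natrM mulnb; congr (_%:R)%R; congr nat_of_bool.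
      case: (leP a r) => //= _; last by rewrite andbF.
      by case: (leP (r : R) s) => //= rs; rewrite (le_trans rs).
    by [].
  rewrite (@RintegralB _ _ R mu [set: R] (fun r => \1_`[a, s] r * f1 r)
    (fun r => \1_`[a, s] r * f2 r))//; [|exact: integrable_fun_indic|exact: integrable_fun_indic].
  by rewrite -!Rintegral_indic; lra.
have kqp : kap (q - p) = k (q - p).
  by rewrite /kap /window_kernel /cut_kern ifT//; lra.
rewrite -Wx ?at_ ?(le_trans tq)// -kqp.
have kmon (x y : R) : 0 < x -> x <= y -> y <= b - a -> kap y <= kap x.
  have [C' HC] := order_weight_le hpsi.
  exact: (cut_kern_nonincreasing (measurable_order_weight hpsi) (order_weight_ge0 hpsi) HC
  (@order_weight_supp _ psi)).
have ksupp (x : R) : 0 < kap x -> 0 < x <= b - a by exact: cut_kern_supp.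
apply: (conv_bound intk k0 kmon ksupp intf fsupp ap pq qb S0 C0) => //.
- by rewrite kqp order_kernel_gt0// subr_gt0.
- move=> s sp; have [sa|as_] := ltP s a; first by rewrite (primitive_lt fsupp).
  by rewrite Wx ?as_/= ?xS ?as_//; lra.
have c1 := distr_caputo_conv hpsi ab if1 E1; have c2 := distr_caputo_conv hpsi ab if2 E2.
have i1 := conv_ae_integrable intk k0 iF1; have i2 := conv_ae_integrable intk k0 iF2.
have := ae_and gC (ae_and D1 (ae_and D2 (ae_and c1 (ae_and c2 (ae_and i1 i2))))).
apply: ae_imp => s [gs [d1 [d2 [e1 [e2 [j1 j2]]]]]] /andP[ps sq].
have sab : a < s < b by rewrite (le_lt_trans ap)//= (lt_le_trans sq).
have -> : conv kap f s = conv kap F1 s - conv kap F2 s.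
  rewrite /conv -(@RintegralB _ _ R mu [set: R] (fun r => kap (s - r) * F1 r)
    (fun r => kap (s - r) * F2 r) measurableT j1 j2).
  by apply: eq_Rintegral => r _; rewrite /f mulrBr.
have -> : conv kap F1 s = g1 s := eq_trans (esym (e1 sab)) (d1 sab).
have -> : conv kap F2 s = g2 s := eq_trans (esym (e2 sab)) (d2 sab).
by apply: gs; rewrite ps.
Qed.

End scalar.

Lemma distr_caputo_norm_le (a b : R) (x1 x2 g1 g2 : R -> R) (p q S C : R) : a < b ->
  abs_cont_seq a b x1 -> abs_cont_seq a b x2 -> x1 a = x2 a ->
  {ae mu, forall s, a < s < b -> distr_caputo a x1 s = g1 s} ->
  {ae mu, forall s, a < s < b -> distr_caputo a x2 s = g2 s} ->
  a <= p -> p < q -> q <= b -> 0 <= S -> 0 <= C ->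
  (forall t, a <= t <= p -> `|x1 t - x2 t| <= S) ->
  {ae mu, forall s : R, p < s < q -> `|g1 s - g2 s| <= C} ->
  forall t, a <= t <= q -> `|x1 t - x2 t| <= S + C / k (q - p).
Proof.
move=> ab ac1 ac2 x12 D1 D2 ap pq qb S0 C0 xS gC t tq.
rewrite ler_norml lerNl opprB; apply/andP; split.
  apply: (distr_caputo_sub_le ab ac2 ac1 _ D2 D1) tq => //.
    by move=> s sp; have := xS s sp; rewrite distrC ler_norml => /andP[].
  by apply: ae_imp gC => s gs ps; have := gs ps; rewrite distrC ler_norml => /andP[].
apply: (distr_caputo_sub_le ab ac1 ac2 _ D1 D2) tq => //.
  by move=> s sp; have := xS s sp; rewrite ler_norml => /andP[].
by apply: ae_imp gC => s gs ps; have := gs ps; rewrite ler_norml => /andP[].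
Qed.

End distributed_comparison.

(** * The max norm and the coordinates *)

Section row_norm.
Context {R : realType} {n : nat}.
Implicit Types A : 'rV[R]_n.

Lemma norm_coord_le A i : `|A 0 i| <= `|A|.
Proof.
rewrite [leRHS]/Num.Def.normr/= mx_normrE.
by apply/bigmax_geP; right; exists (0, i).
Qed.

Lemma norm_row_le A (c : R) : 0 <= c -> (forall i, `|A 0 i| <= c) -> `|A| <= c.
Proof.
move=> c0 Ac; rewrite [leLHS]/Num.Def.normr/= mx_normrE bigmax_le// => -[i j] _ /=.
by rewrite ord1.
Qed.

End row_norm.

(** * Distance between two trajectories *)

Section trajectories.
Context {R : realType} {n m : nat}.
Local Notation mu := (@lebesgue_measure R).
Variables (a b alpha : R) (psi : R -> R) (f : R -> 'rV[R]_n -> 'rV[R]_m -> 'rV[R]_n)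
  (xa : 'rV[R]_n).
Hypotheses (ab : a < b) (hpsi : distr_weight psi).

Let k := order_kernel psi.
Let trajectory := state_trajectory a b alpha psi f xa.

Lemma trajectory_coord u x i : trajectory u x ->
  abs_cont_seq a b (fun s => x s 0 i) /\
  {ae mu, forall s : R, a < s < b ->
     distr_caputo psi a (fun s => x s 0 i) s = f s (x s) (u s) 0 i}.
Proof.
move=> [[acx _ _] Dx _]; split.
  apply: (abs_cont_abs_cont_seq acx) => s t.
  by apply: le_trans (norm_coord_le (x t - x s) i); rewrite !mxE.
apply: ae_imp Dx => s Ds /andP[as_ sb].
by rewrite -Ds ?in_itv/= ?(ltW as_) ?(ltW sb)// mxE.
Qed.

Lemma trajectory_dist u w x y (p q S C : R) : trajectory u x -> trajectory w y ->
  a <= p -> p < q -> q <= b -> 0 <= S -> 0 <= C ->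
  (forall t, a <= t <= p -> `|x t - y t| <= S) ->
  {ae mu, forall s : R, p < s < q -> `|f s (x s) (u s) - f s (y s) (w s)| <= C} ->
  forall t, a <= t <= q -> `|x t - y t| <= S + C / k (q - p).
Proof.
move=> tx ty ap pq qb S0 C0 xyS fC t tq.
have k0 : 0 < k (q - p) by rewrite order_kernel_gt0// subr_gt0.
apply: norm_row_le => [|i]; first by rewrite addr_ge0// divr_ge0// ltW.
have [acx Dx] := trajectory_coord i tx; have [acy Dy] := trajectory_coord i ty.
rewrite !mxE.
apply: (distr_caputo_norm_le hpsi ab acx acy _ Dx Dy ap pq qb S0 C0) tq => //.
- by case: tx => _ _ ->; case: ty => _ _ ->.
- by move=> s sp; apply: le_trans (xyS s sp); apply: le_trans (norm_coord_le _ i); rewrite !mxE.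
apply: ae_imp fC => s fs ps; apply: le_trans (fs ps); apply: le_trans (norm_coord_le _ i).
by rewrite !mxE.
Qed.

(** Comparison with the constant function [xa], whose derivative is zero, over the whole of [[a, b]]
    in one step. The radius is the same for all controls. *)
Lemma trajectory_dist_start u x (M : R) : 0 <= M ->
  (forall t x u, t \in `[a, b] -> `|f t x u| <= M) -> trajectory u x ->
  forall t, a <= t <= b -> `|x t - xa| <= M / k (b - a).
Proof.
move=> M0 fM tx t tab.
have k0 : 0 < k (b - a) by rewrite order_kernel_gt0// subr_gt0.
apply: norm_row_le => [|i]; first by rewrite divr_ge0// ltW.
have [acx Dx] := trajectory_coord i tx; have [[ax _ _] _ xaE] := tx.
rewrite !mxE -[leRHS]add0r.
have acc : abs_cont_seq a b (cst (xa 0 i)).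
  by apply: (abs_cont_abs_cont_seq ax) => r s; rewrite subrr normr0.
have Dc : {ae mu, forall s : R, a < s < b -> distr_caputo psi a (cst (xa 0 i)) s = cst 0 s}.
  by apply: aeW => s _; rewrite distr_caputo_cst.
apply: (distr_caputo_norm_le hpsi ab acx acc _ Dx Dc (lexx a) ab (lexx b) (lexx 0) M0) tab => //=.
- by rewrite xaE.
- by move=> s; rewrite -eq_le => /eqP <-; rewrite xaE subrr normr0.
apply: aeW => s /andP[as_ sb] /=; rewrite subr0.
by apply: le_trans (norm_coord_le _ i) _; rewrite fM// in_itv/= !ltW.
Qed.

Section common_control.
Variables (K : R) (B : set 'rV[R]_n) (u w : R -> 'rV[R]_m) (x y : R -> 'rV[R]_n) (S0 d : R).
Hypotheses (K0 : 0 < K)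
  (lipf : forall x y t u, B x -> B y -> t \in `[a, b] -> `|f t x u - f t y u| <= K * `|x - y|)
  (tx : trajectory u x) (ty : trajectory w y)
  (Bx : forall t, a <= t <= b -> B (x t)) (By : forall t, a <= t <= b -> B (y t))
  (xyS0 : forall t, a <= t <= b -> `|x t - y t| <= S0)
  (d0 : 0 < d) (kd : 2 * K <= k d).

(** With [s] the supremum of the distance on [[a, q]], the right-hand sides differ by at most
    [K * s], and dividing by [k (q - p) >= 2 * K] leaves [s <= S + s / 2]. The rough bound [S0]
    makes [s] finite, so that this can be solved for [s]. *)
Lemma trajectory_step (p q S : R) : a <= p -> p <= q -> q <= b -> q - p <= d -> 0 <= S ->
  {ae mu, forall s : R, p < s < q -> u s = w s} ->
  (forall t, a <= t <= p -> `|x t - y t| <= S) ->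
  forall t, a <= t <= q -> `|x t - y t| <= 2 * S.
Proof.
move=> ap; rewrite le_eqVlt => /predU1P[<- _ _ S0' _ xyS t tp|pq qb qpd S0' uw xyS].
  by apply: le_trans (xyS t tp) _; lra.
pose E : set R := [set z | exists2 t, a <= t <= q & z = `|x t - y t| ].
have aq : a <= q by rewrite (le_trans ap)// ltW.
have Ea : E `|x a - y a| by exists a => //; rewrite lexx.
have supE : has_sup E.
  split; first by exists `|x a - y a|.
  by exists S0 => _ [t /andP[at_ tq] ->]; rewrite xyS0// at_ (le_trans tq).
have leE t : a <= t <= q -> `|x t - y t| <= sup E.
  by move=> tq; apply: sup_upper_bound => //; exists t.
have E0 : 0 <= sup E by apply: le_trans (leE a _); rewrite ?lexx.
have kqp : 2 * K <= k (q - p).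
  apply: le_trans kd _; apply: order_kernel_nonincreasing => //; by rewrite subr_gt0.
have half t : a <= t <= q -> `|x t - y t| <= S + sup E / 2.
  move=> tq; apply: le_trans (trajectory_dist tx ty ap pq qb S0' (_ : 0 <= K * sup E) xyS _ tq) _.
  - by rewrite mulr_ge0// ltW.
  - apply: ae_imp uw => s uws ps; have [ps' sq'] := andP ps; rewrite uws//.
    have sab : a <= s <= b by rewrite (le_trans ap (ltW ps')) (le_trans (ltW sq')).
    apply: le_trans (lipf _ (Bx sab) (By sab) _) _; first by rewrite in_itv.
    by rewrite ler_pM2l// leE//; case/andP: sab => -> _ /=; exact: ltW.
  rewrite lerD2l ler_pdivrMr; last by rewrite (lt_le_trans _ kqp)// mulr_gt0.
  nra.
have : sup E <= S + sup E / 2.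
  by apply: ge_sup; [exists (`|x a - y a|) | move=> _ [t tq ->]; exact: half].
move=> h t tq; apply: le_trans (leE t tq) _; lra.
Qed.

Lemma trajectory_steps (N : nat) (p q S : R) : a <= p -> p <= q -> q <= b -> q - p <= N%:R * d ->
  0 <= S -> {ae mu, forall s : R, p < s < q -> u s = w s} ->
  (forall t, a <= t <= p -> `|x t - y t| <= S) ->
  forall t, a <= t <= q -> `|x t - y t| <= 2 ^+ N * S.
Proof.
elim: N q => [|N IH] q ap pq qb qpd S0' uw xyS t tq.
  have -> : 2 ^+ 0 * S = S by rewrite expr0 mul1r.
  by apply: xyS; move: qpd tq; rewrite mul0r => ? /andP[-> ?]/=; lra.
(* The induction peels off the last step; the maximum with [p] covers an interval that is already
   shorter than [d]. *)
pose r := Num.max p (q - d); have dpos := d0.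
have pr : p <= r by rewrite le_max lexx.
have rq : r <= q by rewrite ge_max pq gerBl ltW.
have SN : 0 <= 2 ^+ N * S by rewrite mulr_ge0// exprn_ge0.
have IHr : forall t, a <= t <= r -> `|x t - y t| <= 2 ^+ N * S.
  apply: IH => //; first by rewrite (le_trans rq).
    rewrite /r; move: qpd; rewrite -natr1 mulrDl mul1r => qpd.
    have Nd : 0 <= N%:R * d by rewrite mulr_ge0// ltW.
    by rewrite lerBlDl ge_max lerDl Nd/=; lra.
  by apply: ae_imp uw => s uws /andP[ps sr]; apply: uws; rewrite ps (lt_le_trans sr).
rewrite exprS -mulrA; apply: (trajectory_step _ rq) tq => //.
- by rewrite (le_trans ap).
- by rewrite lerBlDl -lerBlDr le_max lexx orbT.
by apply: ae_imp uw => s uws /andP[rs sq]; apply: uws; rewrite sq (le_lt_trans pr).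
Qed.

End common_control.

End trajectories.

(** * Effect of a needle variation on the trajectory *)

Section needle.
Context {R : realType} {n m : nat}.
Local Notation mu := (@lebesgue_measure R).
Variables (a b alpha : R) (psi : R -> R) (f : R -> 'rV[R]_n -> 'rV[R]_m -> 'rV[R]_n)
  (xa : 'rV[R]_n).
Hypotheses (ab : a < b) (hpsi : distr_weight psi) (hf : data_assumptions a b f).

Let k := order_kernel psi.
Let trajectory := state_trajectory a b alpha psi f xa.

Lemma needle_trajectory_dist (tau : R) (us : R -> 'rV[R]_m) (xs : R -> 'rV[R]_n) :
  a <= tau -> tau < b -> trajectory us xs ->
  exists2 A : R, 0 < A & forall (theta : R) v u x, 0 < theta ->
    needle_variation a b tau theta v us u -> trajectory u x ->
    forall t, a <= t <= b -> `|x t - xs t| <= A / k theta.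
Proof.
move=> atau taub txs; have [_ _ lip [M M0 fM]] := hf.
pose r := M / k (b - a).
(* A product of segments, hence compact, containing every trajectory: this fixes one Lipschitz
   constant before [theta] and the control are chosen. *)
pose B := [set y : 'rV[R]_n | forall i, `[xa 0 i - r, xa 0 i + r]%classic (y 0 i)].
have cB : compact B.
  have Bi i : compact (`[xa ord0 i - r, xa ord0 i + r]%classic : set R) by exact: segment_compact.
  exact: (rV_compact Bi).
have [K K0 lipK] := lip B cB.
have inB u x t : trajectory u x -> a <= t <= b -> B (x t).
  move=> tx tab i; have := trajectory_dist_start ab hpsi (ltW M0) fM tx tab.
  move/(le_trans (norm_coord_le _ i)); rewrite !mxE ler_norml => /andP[h1 h2].
  by rewrite /= in_itv/= /r; apply/andP; split; lra.
have [d d0 kd'] := order_kernel_near0 hpsi (2 * K).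
have kd : 2 * K <= k d by exact: kd'.
have [N bN] : exists N : nat, b - a <= N%:R * d.
  exists (Num.bound ((b - a) / d)); rewrite -ler_pdivrMr// ltW//.
  by apply: archi_boundP; rewrite divr_ge0// ltW// subr_gt0.
(* [2 * M] bounds the difference of the right-hand sides on the needle; [N] steps of length [d]
   cover all of [[a, b]], hence also what follows the needle. *)
exists (2 ^+ N * (2 * M)); first by rewrite !mulr_gt0// exprn_gt0.
move=> theta v u x theta0 [_ uE] tx.
have kt : 0 < k theta by exact: order_kernel_gt0.
have xyS t : a <= t <= b -> `|x t - xs t| <= r + r.
  move=> tab; rewrite (le_trans (ler_distD xa _ _))// lerD//.
    exact: (trajectory_dist_start ab hpsi (ltW M0) fM tx tab).
  by rewrite distrC; exact: (trajectory_dist_start ab hpsi (ltW M0) fM txs tab).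
have steps := trajectory_steps ab hpsi K0 lipK tx txs (fun t => inB u x t tx)
  (fun t => inB us xs t txs) xyS d0 kd.
(* The needle may begin before [a]; only its part inside [[a, b]] acts. *)
pose p := Num.max a (tau - theta).
have ap : a <= p by rewrite le_max lexx.
have ptau : p <= tau by rewrite ge_max atau gerBl ltW.
(* The controls agree up to [p], and doubling an initial distance [0] any number of times leaves
   [0]. *)
have before t : a <= t <= p -> `|x t - xs t| <= 0.
  move=> tp; rewrite -[leRHS](mulr0 (2 ^+ N)).
  apply: (steps N a p 0) => //.
  - by rewrite (le_trans ptau)// ltW.
  - by apply: le_trans bN; rewrite lerD2r (le_trans ptau)// ltW.
  - apply: ae_imp uE => s us_s /andP[as_ sp].
    rewrite us_s ?in_itv/= ?(ltW as_)/= ?(le_trans (ltW sp)) ?(le_trans ptau (ltW taub))//.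
    have : s < tau - theta by move: sp; rewrite lt_max ltNge (ltW as_).
    by rewrite ltNge => /negbTE ->.
  - move=> s; rewrite -eq_le => /eqP <-.
    by case: tx => _ _ ->; case: txs => _ _ ->; rewrite subrr normr0.
pose S1 := 2 * M / k theta.
have M20 : 0 <= 2 * M by rewrite mulr_ge0// ltW.
have S10 : 0 <= S1 := divr_ge0 M20 (ltW kt).
have needle t : a <= t <= tau -> `|x t - xs t| <= S1.
  move: ptau; rewrite le_eqVlt => /predU1P[<-|ptau] tt.
    by rewrite (le_trans (before t tt)).
  apply: le_trans (trajectory_dist ab hpsi tx txs ap ptau (ltW taub) (lexx 0) M20 before _ tt) _.
    apply: aeW => s /andP[ps st]; have sab : s \in `[a, b].
      by rewrite in_itv/= (le_trans ap (ltW ps)) (le_trans (ltW st) (ltW taub)).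
    by rewrite mulr_natl mulr2n (le_trans (ler_normB _ _))// lerD// fM.
  have ptau0 : 0 < tau - p by rewrite subr_gt0.
  (* The part of the needle inside [[a, b]] has length at most [theta], and the kernel is
     nonincreasing. *)
  have ktheta : k theta <= k (tau - p).
    apply: (order_kernel_nonincreasing hpsi ptau0).
    by rewrite lerBlDl -lerBlDr le_max lexx orbT.
  rewrite add0r; apply: (ler_wpM2l M20).
  by rewrite lef_pV2; [exact: ktheta|exact: (lt_le_trans kt ktheta)|exact: kt].
move=> t tab; rewrite -mulrA.
apply: (steps N tau b S1) => //.
- exact: ltW.
- by apply: le_trans bN; rewrite lerD2l lerN2.
apply: ae_imp uE => s us_s /andP[ts sb].
by rewrite us_s ?in_itv/= ?(ltW sb) ?(ltNge _ tau) ?(ltW ts) ?andbF//= (le_trans atau (ltW ts)).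
Qed.

End needle.

(** * Uniform convergence of the perturbed trajectories *)

Theorem lemma3 (R : realType) (n m : nat) (a b alpha : R) (hab : a < b)
    (halpha : alpha \in `[0, 1])
    (psi : R -> R) (hpsi : distr_weight psi)
    (f : R -> 'rV[R]_n -> 'rV[R]_m -> 'rV[R]_n)
    (L : R -> 'rV[R]_n -> 'rV[R]_m -> R)
    (hf : data_assumptions a b f) (hL : data_assumptions a b L)
    (Omega : set 'rV[R]_m) (hOmega : closed Omega) (xa : 'rV[R]_n)
    (xs : R -> 'rV[R]_n) (us : R -> 'rV[R]_m)
    (hopt : optimal_pair a b alpha psi f L xa Omega xs us)
    (tau : R) (htau : tau \in `[a, b[)
    (htauf : lebesgue_pt_in a b (fun t => f t (xs t) (us t)) tau)
    (htauL : lebesgue_pt_in a b (fun t => L t (xs t) (us t)) tau)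
    (v : 'rV[R]_m) (hv : Omega v)
    (utheta : R -> R -> 'rV[R]_m)
    (hu : forall theta, theta \in `[0, b - tau[ ->
            needle_variation a b tau theta v us (utheta theta))
    (xtheta : R -> R -> 'rV[R]_n)
    (hx : forall theta, theta \in `[0, b - tau[ ->
            state_trajectory a b alpha psi f xa (utheta theta) (xtheta theta)) :
  {uniform `[a, b], xtheta theta @[theta --> (0 : R)^'+] --> xs}.
Proof.
have [[txs _ _] _] := hopt.
have /andP[atau taub] : a <= tau < b by move: htau; rewrite in_itv.
have [A A0 HA] := needle_trajectory_dist hab hpsi hf atau taub txs.
move=> V /uniform_nbhs[E [entE EV]]; apply: filterS EV _.
have [e /= e0 eE] : exists2 e : R, 0 < e &
    [set z : 'rV[R]_n * 'rV[R]_n | `|z.1 - z.2| < e] `<=` E.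
  by move: entE; rewrite -entourage_ballE => -[e /= e0 eE]; exists e => //;
    move: eE; rewrite -ball_normE.
(* The factor [2] makes [A / k theta] at most [e / 2], hence strictly below [e]. *)
have [d d0 kd] := order_kernel_near0 hpsi (2 * A / e).
near=> theta => t /= tab.
have theta0 : 0 < theta by near: theta; exact: nbhs_right_gt.
have thetab : theta < b - tau by near: theta; apply: nbhs_right_lt; rewrite subr_gt0.
have thetad : theta <= d by near: theta; exact: nbhs_right_le.
have thetaI : theta \in `[0, b - tau[ by rewrite in_itv/= ltW.
apply: eE => /=; rewrite distrC.
have tab' : a <= t <= b by move: tab; rewrite in_itv.
have H := HA _ _ _ _ theta0 (hu _ thetaI) (hx _ thetaI) _ tab'.
apply: (le_lt_trans H); have := kd _ theta0 thetad; rewrite ler_pdivrMr// => h.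
by rewrite ltr_pdivrMr ?order_kernel_gt0//; lra.
Unshelve. all: by end_near. Qed.
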